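(* Let $\tau$ be a nontrivial irreducible type of width $k$ whose block decomposition has $b$ blocks. Then, as $n\to\infty$, \[ (1+o(1))\log_{(b-2)}\bigl(\tfrac nk\bigr)\le \chi\bigl( G(n,\tau)\bigr)\le \bigl( 2^{(b-2)^2}+o(1)\bigr)\log_{(b-2)}(n)\,, \] and hence $\chi\bigl( G(n,\tau)\bigr)= \Theta\bigl(\log_{(b-2)}(n)\bigr)$.
   Context: For finite sets $X,Y\subseteq\mathbb{Q}$ with $X\cup Y=\{z_1<z_2<\dots<z_\ell\}$, the order type $\tau(X,Y)$ is the sequence $(\tau_1,\dots,\tau_\ell)$ with $\tau_i=1$ if $z_i\in X\setminus Y$, $\tau_i=2$ if $z_i\in Y\setminus X$, and $\tau_i=3$ if $z_i\in X\cap Y$. A type of width $k$ and length $\ell$ is the order type of a pair $(X,Y)$ with $|X|=|Y|=k$ and $|X\cup Y|=\ell$; the empty sequence is the empty type. A type is trivial if all its entries equal $3$. Juxtaposition $\tau\tau'$ denotes concatenation of sequences. A nonempty type is irreducible if it cannot be written as the concatenation of two nonempty types. For a finite sequence $B$ of ones, twos and threes, $\mathbf{1}(B)$ denotes the number of entries of $B$ equal to $1$ or $3$, and $\mathbf{2}(B)$ the number of entries equal to $2$ or $3$. A nontrivial irreducible type starts with $1$ (primary) or with $2$ (secondary). Block decomposition of a primary irreducible type $\tau$: reading $\tau$ from left to right, the first block $B_1$ consists of all initial ones of $\tau$; once $B_i$ has been constructed, the next block $B_{i+1}$ consists of the next consecutive entries of $\tau$ such that $\mathbf{2}(B_{i+1})=\mathbf{1}(B_i)$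 and, subject to this, $B_{i+1}$ is as long as possible; the process stops once all entries of $\tau$ are placed in blocks, giving $\tau=B_1B_2\cdots B_b$, and $b$ is the number of blocks. For a secondary irreducible type $\tau$, let $\tau'$ be obtained by interchanging ones and twos; its block decomposition is obtained from that of $\tau'$ by interchanging ones and twos back, so $\tau$ and $\tau'$ have the same number of blocks. For a nontrivial type $\tau$ of width $k$ and $n\ge k$, the type-graph $G(n,\tau)$ has vertex set $\binom{[n]}{k}$ (the $k$-subsets of $[n]=\{1,\dots,n\}$), with $X,Y$ adjacent iff $\tau(X,Y)=\tau$ or $\tau(Y,X)=\tau$. $\log_{(t)}$ denotes the $t$-fold iterated base-$2$ logarithm, with $\log_{(0)}(n)=n$. *)

(* Defs.v *)
From HB Require Import structures.
From mathcomp Require Import all_boot all_order all_algebra finmap.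
From mathcomp Require Import all_classical all_reals all_analysis.

Set Implicit Arguments.
Unset Strict Implicit.
Unset Printing Implicit Defensive.

Import Order.TTheory GRing.Theory Num.Theory.
Import numFieldNormedType.Exports.

Local Open Scope nat_scope.

(* Stated over an arbitrary linear order, so that it applies both to subsets  *)
(* of rat and to subsets of 'I_n, which plays the role of {1, ..., n}: only   *)
(* the order of the elements matters.                                         *)
Definition order_type d (T : orderType d) (X Y : {fset T}) : seq nat :=
  [seq if z \in X then (if z \in Y then 3 else 1) else 2
     | z <- sort <=%O (X `|` Y)%fset].

Definition is_type_of_width (k : nat) (tau : seq nat) : Prop :=
  exists X Y : {fset rat},
    [/\ #|` X| = k, #|` Y| = k & order_type X Y = tau].

Definition is_type (tau : seq nat) : Prop := exists k, is_type_of_width k tau.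

Definition trivial_type (tau : seq nat) : bool := all (pred1 3) tau.

Definition irreducible_type (tau : seq nat) : Prop :=
  tau <> [::] /\
  forall t1 t2 : seq nat, is_type t1 -> is_type t2 ->
    t1 <> [::] -> t2 <> [::] -> tau <> t1 ++ t2.

Definition ones (B : seq nat) : nat := count (fun a => (a == 1) || (a == 3)) B.
Definition twos (B : seq nat) : nat := count (fun a => (a == 2) || (a == 3)) B.

(* Length of the longest prefix C of s with twos C = m. *)
Definition block_length (m : nat) (s : seq nat) : nat :=
  \max_(j < (size s).+1 | twos (take j s) == m) j.

(* The blocks that follow a block B with ones B = m, where s is the part of   *)
(* the type not yet placed in blocks. As every block of an irreducible type   *)
(* is nonempty, size s is enough fuel: see primary_blocksP below.             *)
Fixpoint next_blocks (fuel m : nat) (s : seq nat) : seq (seq nat) :=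
  if fuel is f.+1 then
    if s is [::] then [::] else
      let j := block_length m s in
      take j s :: next_blocks f (ones (take j s)) (drop j s)
  else [::].

Definition primary_blocks (tau : seq nat) : seq (seq nat) :=
  let j := find (predC (pred1 1)) tau in
  take j tau :: next_blocks (size tau) (ones (take j tau)) (drop j tau).

Definition swap12 (a : nat) : nat :=
  if a == 1 then 2 else if a == 2 then 1 else a.

(* Only meaningful for nontrivial irreducible types. *)
Definition blocks (tau : seq nat) : seq (seq nat) :=
  if head 0 tau == 1 then primary_blocks tau
  else map (map swap12) (primary_blocks (map swap12 tau)).

Definition ksubset (n k : nat) : finType := {X : {set 'I_n} | #|X| == k}.

Definition type_graph (n k : nat) (tau : seq nat) : rel (ksubset n k) :=
  fun X Y =>
    let ot (U V : {set 'I_n}) :=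
      order_type [fset i in U]%fset [fset i in V]%fset in
    (ot (val X) (val Y) == tau) || (ot (val Y) (val X) == tau).

Definition colorable (T : finType) (e : rel T) (m : nat) : bool :=
  [exists f : {ffun T -> 'I_m}, [forall x, forall y, e x y ==> (f x != f y)]].

(* The search is limited to m <= #|T|, which is enough for a loopless graph.  *)
Definition chromatic_number (T : finType) (e : rel T) : nat :=
  [arg min_(m < (ord_max : 'I_#|T|.+1) | colorable e m) (m : nat)]%N.

Definition log2 (R : realType) (x : R) : R := (ln x / ln 2)%R.

(* Since ln is total with ln x = 0 for x <= 0, this is the iterated logarithm *)
(* only where the latter is defined, that is for x large in terms of t.       *)
Definition iter_log2 (R : realType) (t : nat) (x : R) : R := iter t (@log2 R) x.

Definition wf_entries (t : seq nat) : bool := all [in [:: 1; 2; 3]] t.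

Lemma ones_cat s t : ones (s ++ t) = ones s + ones t.
Proof. exact: count_cat. Qed.

Lemma twos_cat s t : twos (s ++ t) = twos s + twos t.
Proof. exact: count_cat. Qed.

Lemma is_type_of_widthE k t :
  is_type_of_width k t <-> [/\ wf_entries t, ones t = k & twos t = k].
Proof.
split=> [[X [Y [cX cY <-]]] | [wf_t t1 t2]].
  split; first by apply/allP => a /mapP[z _ ->]; do 2?case: ifP.
    rewrite -cX /ones count_map -size_filter; apply: perm_size.
    apply: uniq_perm; rewrite ?filter_uniq ?sort_uniq ?fset_uniq // => z.
    rewrite mem_filter mem_sort in_fsetU /=.
    by case: (z \in X) (z \in Y) => [] [].
  rewrite -cY /twos count_map -size_filter; apply: perm_size.
  apply: uniq_perm; rewrite ?filter_uniq ?sort_uniq ?fset_uniq // => z.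
  rewrite mem_filter mem_sort in_fsetU /=.
  by case: (z \in X) (z \in Y) => [] [].
pose q (i : nat) : rat := i%:R%R.
have q_inj : injective q by move=> i j /eqP; rewrite eqr_nat => /eqP.
pose F (P : pred nat) : {fset rat} :=
  [fset q i | i in [seq i <- iota 0 (size t) | P (nth 0 t i)]]%fset.
have FE P i : (q i \in F P) = (i < size t) && P (nth 0 t i).
  rewrite mem_imfset //= mem_filter mem_iota add0n andbC //.
have cF P : #|` F P| = count P t.
  rewrite card_imfset //= undup_id ?filter_uniq ?iota_uniq // size_filter.
  by rewrite -[in RHS](mkseq_nth 0 t) count_map.
exists (F (fun a => (a == 1) || (a == 3))), (F (fun a => (a == 2) || (a == 3))).
rewrite !cF; split=> //.
set X := F _; set Y := F _.
have srt : sort <=%O (X `|` Y)%fset = map q (iota 0 (size t)).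
  apply: (@sorted_eq _ <=%O); [exact: le_trans|exact: le_anti| | |].
  - exact/sort_sorted/le_total.
  - rewrite sorted_map; apply: sub_sorted (iota_sorted _ _) => i j /=.
    by rewrite /q ler_nat.
  - rewrite perm_sort; apply: uniq_perm.
    + exact: fset_uniq.
    + by rewrite map_inj_uniq // iota_uniq.
    move=> z; rewrite in_fsetU; apply/idP/idP.
      case/orP => /imfsetP[i /=]; rewrite mem_filter => /andP[_ ii] ->;
        exact: map_f.
    case/mapP => i; rewrite mem_iota add0n => /= lti ->; rewrite !FE lti /=.
    by have := allP wf_t _ (mem_nth 0 lti); rewrite !inE => /or3P[] /eqP ->.
rewrite /order_type srt -map_comp -[RHS](mkseq_nth 0 t); apply/eq_in_map => i.
rewrite mem_iota add0n => /= lti; rewrite !FE lti /=.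
by have := allP wf_t _ (mem_nth 0 lti); rewrite !inE => /or3P[] /eqP ->.
Qed.

Lemma block_length_twos m s :
  m <= twos s -> twos (take (block_length m s) s) = m.
Proof.
move=> le_ms; have [j0 tj0] : exists j : 'I_(size s).+1, twos (take j s) == m.
  elim: s m le_ms => [|a s IHs] m; first by exists ord0; rewrite eq_sym -leqn0.
  rewrite /twos /= -/(twos s); case: m => [|m] le_ms.
    by exists ord0; rewrite take0.
  have {}/IHs[j jE] : m.+1 - ((a == 2) || (a == 3)) <= twos s.
    by rewrite leq_subLR.
  exists (lift ord0 j); rewrite /= -/(twos (take j s)) (eqP jE) subnKC //.
  by case: (_ || _).
rewrite /block_length; have [|j /eqP jE ->] //:= @eq_bigmax_cond _
  [pred j : 'I_(size s).+1 | twos (take j s) == m] (fun j => j : nat).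
by apply/card_gt0P; exists j0.
Qed.

Lemma next_blocksP f B p s : size s <= f -> p != [::] ->
    ones (p ++ s) = twos (p ++ s) ->
    (forall j, 0 < j < size (p ++ s) ->
       ones (take j (p ++ s)) <> twos (take j (p ++ s))) ->
    twos p + ones B = ones p ->
  flatten (next_blocks f (ones B) s) = s /\
  path (fun C C' => twos C' == ones C) B (next_blocks f (ones B) s).
Proof.
elim: f B p s => [|f IHf] B p s; first by case: s.
move=> les p0 eqps irr_ps pB /=; case: s => [|a s] // in les eqps irr_ps *.
set s' := a :: s in les eqps irr_ps *; set C := take _ s'.
have size_p : 0 < size p by case: (p) p0.
have B_gt0 : 0 < ones B.
  rewrite lt0n; apply/eqP => B0; apply: (irr_ps (size p)).
    by rewrite size_p size_cat /= addnS ltnS leq_addr.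
  by rewrite take_size_cat // -pB B0 addn0.
have C2 : twos C = ones B.
  apply: block_length_twos; move: eqps; rewrite ones_cat twos_cat -pB -addnA.
  by move/addnI <-; apply: leq_addr.
have j_gt0 : 0 < block_length (ones B) s'.
  by rewrite lt0n; apply: contraTneq B_gt0 => j0; rewrite -C2 /C j0 take0.
have [||||//|E1 E2] := IHf C (p ++ C) (drop (block_length (ones B) s') s').
- rewrite size_drop; apply: leq_trans (leq_sub2l _ j_gt0) _.
  by rewrite subn1 -ltnS; apply: leq_trans les.
- by case: (p) p0.
- by rewrite -catA cat_take_drop.
- by rewrite -catA cat_take_drop.
- by rewrite twos_cat ones_cat C2 pB.
by rewrite /= E1 cat_take_drop C2 eqxx.
Qed.

Lemma irreducible_prefix k t j : is_type_of_width k t -> irreducible_type t ->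
  0 < j < size t -> ones (take j t) <> twos (take j t).
Proof.
move=> /is_type_of_widthE[+ t1 t2] [_ irr_t] /andP[j_gt0 j_lt] eqj.
rewrite -[t in wf_entries t](cat_take_drop j t) /wf_entries all_cat.
case/andP => wf1 wf2.
have eqd : ones (drop j t) = twos (drop j t).
  apply/(@addnI (ones (take j t))); rewrite -ones_cat eqj -twos_cat.
  by rewrite cat_take_drop t1 t2.
apply: (irr_t (take j t) (drop j t)); last by rewrite cat_take_drop.
- by exists (ones (take j t)); apply/is_type_of_widthE; split.
- by exists (ones (drop j t)); apply/is_type_of_widthE; split.
- move/(congr1 size); rewrite size_takel ?(ltnW j_lt) // => j0.
  by rewrite j0 in j_gt0.
- by move/(congr1 size)/eqP; rewrite size_drop /= subn_eq0 leqNgt j_lt.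
Qed.

(* For a primary irreducible type the recursion places every entry in a       *)
(* block, with twos B_(i+1) = ones B_i, and there are at least two blocks.    *)
Lemma primary_blocksP k t : is_type_of_width k t -> irreducible_type t ->
    head 0 t = 1 ->
  [/\ flatten (primary_blocks t) = t,
      sorted (fun C C' => twos C' == ones C) (primary_blocks t) &
      1 < size (primary_blocks t)].
Proof.
move=> kt irr_t hd_t; have irr_pre := irreducible_prefix kt irr_t.
have [_ t1 t2] := (is_type_of_widthE k t).1 kt.
rewrite /primary_blocks; set j := find _ t.
have j_gt0 : 0 < j by rewrite /j; case: (t) hd_t => //= a s ->.
have B1 : all (pred1 1) (take j t).
  by rewrite -(negbK (all _ _)) -has_predC has_take_leq ?find_size // ltnn.
have B2 : twos (take j t) = 0.
  apply/eqP; rewrite /twos -leqn0 leqNgt -has_count; apply/hasPn => a.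
  by move/(allP B1) => /eqP ->.
have t_n0 : t != [::] by case: (t) hd_t.
have tk_n0 : take j t != [::].
  by case: (t) t_n0 j_gt0 => //= a s _; case: (j).
have [||||//|E1 E2] := @next_blocksP (size t) (take j t) (take j t) (drop j t).
- by rewrite size_drop leq_subr.
- by [].
- by rewrite cat_take_drop t1 t2.
- by rewrite cat_take_drop.
- by rewrite B2.
split=> //=; first by rewrite E1 cat_take_drop.
rewrite ltnS lt0n; apply/negP => /nilP E0; move: E1; rewrite E0 /= => d0.
have tE : take j t = t by rewrite -[RHS](cat_take_drop j) -d0 cats0.
have k0 : k = 0 by rewrite -t2 -tE B2.
move/eqP: t1; rewrite k0.
rewrite /ones -leqn0 leqNgt -has_count; apply/negP/negPn/hasP.
by exists 1 => //; case: (t) hd_t => //= a s ->; rewrite mem_head.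
Qed.

Lemma type_graph_sym n k tau : symmetric (@type_graph n k tau).
Proof. by move=> X Y; rewrite /type_graph orbC. Qed.

Lemma type_graph_irrefl n k tau :
  ~~ trivial_type tau -> irreflexive (@type_graph n k tau).
Proof.
move=> ntau X; rewrite /type_graph orbb; apply: contraNF ntau => /eqP <-.
apply/allP => a /mapP[z]; rewrite mem_sort in_fsetE orbb => zX ->.
by rewrite zX.
Qed.

Lemma chromatic_numberP (T : finType) (e : rel T) : irreflexive e ->
  colorable e (chromatic_number e) /\
  forall m, colorable e m -> chromatic_number e <= m.
Proof.
move=> irr_e; rewrite /chromatic_number.
have cT : colorable e (ord_max : 'I_#|T|.+1).
  apply/existsP; exists [ffun x => enum_rank x].
  apply/forallP => x; apply/forallP => y; apply/implyP => exy; rewrite !ffunE.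
  by apply: contraTneq exy => /enum_rank_inj ->; rewrite irr_e.
case: arg_minnP => // i ci mini; split=> // m cm.
have [le_mT | lt_Tm] := leqP m #|T|; last first.
  exact: leq_trans (ltn_ord i : i <= #|T|) (ltnW lt_Tm).
exact: (mini (Ordinal (le_mT : m < #|T|.+1))).
Qed.

(* Main.v *)
(* Write a primary type as blocks B_1 ... B_b and put d = b - 1.  If (X, Y)   *)
(* realises it, X splits into consecutive parts X_1, ..., X_d with |X_i| =    *)
(* ones B_i, Y splits likewise, and B_(i+1) is the relative position of       *)
(* X_(i+1) and Y_i.                                                           *)
(*                                                                            *)
(* Lower bound: choose sets S_1, ..., S_d of rationals in (0, 1) such that    *)
(* S_(i+1) and S_i are in the relative position B_(i+1).  Sending a d-set     *)
(* x_1 < ... < x_d to the union of the x_i + S_i maps the shift graph on      *)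
(* d-sets of a set of n / k points into the type-graph.                       *)
(*                                                                            *)
(* Upper bound: with a_i = min X_i and f_i = max X_i, adjacency forces        *)
(* f_i <= a'_i <= a_(i+1) <= max (a'_i, f'_i), where primes refer to Y.       *)
(* Replace a_i by the level at which the binary expansions of a_i and a_(i+1) *)
(* split.  On vertices agreeing on 2(d-1)-1 comparison bits this produces,    *)
(* when the new sequence is monotone, an edge of the same kind with d - 1     *)
(* parts among at most log n + 2 points; sequences which are not monotone     *)
(* need only boundedly many colours.  Iterating gives the factor              *)
(* 2^(1 + 3 + ... + (2(d-1)-1)) = 2^((d-1)^2).                                *)

Require Import Defs.
From HB Require Import structures.
From mathcomp Require Import all_boot all_order all_algebra finmap.
From mathcomp Require Import all_classical all_reals all_analysis.
From mathcomp Require Import zify lra.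

Set Implicit Arguments.
Unset Strict Implicit.
Unset Printing Implicit Defensive.
Import Order.TTheory GRing.Theory Num.Theory.
Import numFieldNormedType.Exports.

Local Open Scope nat_scope.

(** In the lemmas [d] stands for b - 2, and [primary_reduction] makes the type primary.

    Upper bound: [part_iedge] turns adjacency into an edge of the interval shift graph with d + 1
    parts. [icoloring_step] removes one part while replacing the number of points by its logarithm:
    adjacent intervals never split at the same binary level ([split_level_neq]), so the split levels
    of consecutive first elements form an edge of the same kind once a bounded number of comparisons
    is fixed. After d steps only distinct numbers remain to be told apart, and [ibound_near]
    evaluates the resulting recursion.

    Lower bound: by [shift_graph_hom] a proper colouring of the type-graph colours a shift graph on
    (d + 1)-tuples with one more colour, so by [shift_graph_coloring] n / k is at most a tower of
    height d over that number of colours; [iter_log2_tower] takes logarithms.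

    All remaining errors are additive constants, negligible against a divergent iterated
    logarithm. *)

(** * Binary split levels and the interval shift graph *)

Lemma split_level_ex x y : exists h, x %/ 2 ^ h == y %/ 2 ^ h.
Proof.
exists (x + y); have lt2 := ltn_expl (x + y) (isT : 1 < 2).
by rewrite !divn_small //; apply: leq_ltn_trans lt2; rewrite ?leq_addr ?leq_addl.
Qed.

(** The exponent of the smallest dyadic interval containing both points. *)
Definition split_level x y := ex_minn (split_level_ex x y).

Lemma split_level_le x y h :
  (split_level x y <= h) = (x %/ 2 ^ h == y %/ 2 ^ h).
Proof.
rewrite /split_level; case: ex_minnP => m /eqP xy minm; apply/idP/idP.
  by move/subnKC <-; rewrite expnD !divnMA xy.
exact: minm.
Qed.

Lemma split_level_gt0 x y : x < y -> 0 < split_level x y.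
Proof. by rewrite lt0n -leqn0 split_level_le !divn1 => xy; rewrite neq_ltn xy. Qed.

Lemma split_levelS x y z w : z <= x -> x <= y -> y <= w ->
  split_level x y <= split_level z w.
Proof.
move=> zx xy yw; have := leqnn (split_level z w).
rewrite {1}split_level_le split_level_le; move: (2 ^ _) => h zw.
have := leq_div2r h zx; have := leq_div2r h xy; have := leq_div2r h yw.
lia.
Qed.

Lemma split_level_max x y z : x <= y -> y <= z ->
  split_level x z = maxn (split_level x y) (split_level y z).
Proof.
move=> xy yz; apply/eqP; rewrite eqn_leq geq_max !split_levelS // !andbT.
move: (leq_maxl (split_level x y) (split_level y z)).
move: (leq_maxr (split_level x y) (split_level y z)).
by move: (maxn _ _) => m; rewrite !split_level_le => /eqP <- /eqP ->.
Qed.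

(** At a common level [h.+1] the three points would share a dyadic interval while lying in three
    different halves of it. *)
Lemma split_level_neq x y z : x < y -> y < z ->
  split_level x y <> split_level y z.
Proof.
move=> xy yz; have := split_level_gt0 xy.
case E: (split_level x y) => [//|h] _ E'.
have := split_level_le x y h; have := split_level_le x y h.+1.
have := split_level_le y z h; have := split_level_le y z h.+1.
rewrite E -E' leqnn ltnn !expnSr !divnMA.
have := leq_div2r (2 ^ h) (ltnW xy); have := leq_div2r (2 ^ h) (ltnW yz).
move: (_ %/ _) (y %/ _) (z %/ _) => p q r; lia.
Qed.

Lemma split_level_bound x y l : x < 2 ^ l -> y < 2 ^ l -> split_level x y <= l.
Proof. by move=> xl yl; rewrite split_level_le !divn_small. Qed.

(* The interval shift graph: a vertex is a pair (a, f), of which only the     *)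
(* entries a 0, ..., a d.-1 and f 0, ..., f d.-2 matter.                      *)
Definition ivertex d N (a f : nat -> nat) : Prop :=
  (forall i, i < d -> a i < N) /\
  (forall i, i.+1 < d -> a i < a i.+1 /\ f i < a i.+1).

Definition iedge d (a f a' f' : nat -> nat) : Prop :=
  a 0 <> a' 0 /\
  forall i, i.+1 < d ->
    [/\ f i <= a' i, a' i <= a i.+1 & a i.+1 <= maxn (a' i) (f' i)].

Definition icoloring d N (C : Type) (col : (nat -> nat) -> (nat -> nat) -> C) :=
  forall a f a' f', ivertex d N a f -> ivertex d N a' f' ->
    iedge d a f a' f' -> col a f <> col a' f'.

(** * Passing from first elements to split levels *)

Section Reduction.
Variables a f : nat -> nat.

Definition iright i := maxn (a i) (f i).
Definition inner_level i := split_level (a i) (iright i).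
Definition gap_level i := split_level (iright i) (a i.+1).
Definition level i := split_level (a i) (a i.+1).
(** The dyadic split between [a i] and [a i.+1] then falls into the gap, leaving [iright i] on the
    left with [a i]. *)
Definition left_type i := inner_level i < gap_level i.
Definition ascent i := level i < level i.+1.
(** The floors take the role of [f] in the reduced vertices, read forwards for ascending and
    backwards for descending levels. The value 0 replaces an inner or gap level equal to the whole
    level, since [ivertex] demands strict inequalities. *)
Definition up_floor i := if left_type i.+1 then inner_level i.+1 else 0.
Definition down_floor i := if left_type i then 0 else gap_level i.

Variables (d N : nat).
Hypothesis af : ivertex d.+1 N a f.

Lemma iright_bounds i : i < d -> a i <= iright i < a i.+1.
Proof. by move=> id; have [_ /(_ i id)] := af; rewrite /iright; lia. Qed.

Lemma inner_level0 i : f i <= a i -> inner_level i = 0.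
Proof.
move=> /maxn_idPl r0; apply/eqP.
by rewrite -leqn0 split_level_le /iright r0.
Qed.

Lemma level_max i : i < d -> level i = maxn (inner_level i) (gap_level i).
Proof.
by move=> /iright_bounds/andP[? ?]; apply: split_level_max => //; apply: ltnW.
Qed.

Lemma gap_level_gt0 i : i < d -> 0 < gap_level i.
Proof. by move=> /iright_bounds/andP[_]; apply: split_level_gt0. Qed.

Lemma inner_level_neq i : i < d -> inner_level i <> gap_level i.
Proof.
move=> id; have := gap_level_gt0 id; have /andP[+ lt] := iright_bounds id.
rewrite leq_eqVlt => /predU1P[E | lt' _]; last exact: split_level_neq.
have ->: inner_level i = 0 by apply/eqP; rewrite -leqn0 split_level_le -E.
by lia.
Qed.

Lemma level_neq i : i.+1 < d -> level i <> level i.+1.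
Proof.
move=> id; have [_ af2] := af; have [? _] := af2 _ (ltnW id : i.+1 < d.+1).
by have [? _] := af2 i.+1 id; apply: split_level_neq.
Qed.

Lemma up_floor_lt i : i.+1 < d -> up_floor i < level i.+1.
Proof.
move=> id; rewrite level_max //; have := gap_level_gt0 id.
by rewrite /up_floor /left_type; case: ifP; lia.
Qed.

Lemma down_floor_lt i : i < d -> down_floor i < level i.
Proof.
move=> id; rewrite level_max //; have := gap_level_gt0 id.
have := inner_level_neq id.
by rewrite /down_floor /left_type; case: ifP; lia.
Qed.

Lemma level_bound l i : N <= 2 ^ l -> i < d -> level i < l.+1.
Proof.
move=> Nl id; have [af1 _] := af; rewrite ltnS.
by apply: split_level_bound; apply: leq_trans Nl; apply: af1; lia.
Qed.

End Reduction.

Section ReducedEdge.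
Variables (d N : nat) (a f a' f' : nat -> nat).
Hypotheses (af : ivertex d.+1 N a f) (af' : ivertex d.+1 N a' f').
Hypothesis e : iedge d.+1 a f a' f'.
Hypothesis same_type : forall i, i < d -> left_type a f i = left_type a' f' i.

Let edge_bounds i : i < d ->
  [/\ f i <= a' i, a' i <= a i.+1 & a i.+1 <= iright a' f' i].
Proof. by have [_ +] := e => /[apply]. Qed.

(** If both splits fall into the gaps, consider [a i], [a i.+1], [a' i.+1]; otherwise [a i], [a' i],
    [iright a' f' i]. Either way the two levels belong to adjacent intervals, and [split_level_neq]
    separates them. *)
Lemma level_edge_neq i : i < d -> level a i <> level a' i.
Proof.
move=> id E; have [fa aa ar] := edge_bounds id.
have /andP[b1 b2] := iright_bounds af id; have /andP[b3 b4] := iright_bounds af' id.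
have Mx := level_max af id; have My := level_max af' id.
have := same_type id; rewrite /left_type => st.
have ni := inner_level_neq af id; have ni' := inner_level_neq af' id.
have [lt|ge] := ltnP (inner_level a f i) (gap_level a f i).
  have lt' : inner_level a' f' i < gap_level a' f' i by lia.
  have h1 := split_levelS aa ar (leqnn _).
  have h2 := split_level_max ar (ltnW b4).
  have lt2 : a i < a i.+1 by lia.
  have lt3 : a i.+1 < a' i.+1 by lia.
  apply: (split_level_neq lt2 lt3).
  rewrite -/(level a i) h2 -/(gap_level a' f' i) E My.
  by move: h1; rewrite -/(inner_level a' f' i); lia.
have ge' : gap_level a' f' i <= inner_level a' f' i by lia.
have ltaf : a i < f i.
  rewrite ltnNge; apply/negP => le; have := gap_level_gt0 af id.
  by have := inner_level0 le; lia.
have ifr : iright a f i = f i by rewrite /iright; lia.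
have h1 : split_level (a' i) (a i.+1) <= gap_level a f i.
  by apply: split_levelS; rewrite ?ifr.
have lt2 : a i < a' i by lia.
have h2 := split_level_max (ltnW lt2) aa.
have lt3 : a' i < iright a' f' i.
  rewrite /iright leq_max ltnn ltnNge; apply/negP => le.
  by have := gap_level_gt0 af' id; have := inner_level0 le; lia.
apply: (split_level_neq lt2 lt3); rewrite -/(inner_level a' f' i).
by move: h2; rewrite -/(level a i); lia.
Qed.

Lemma level_edge i : i.+1 < d ->
  [/\ inner_level a f i.+1 <= level a' i,
      gap_level a' f' i <= level a i.+1,
      level a' i <= maxn (gap_level a f i) (level a i.+1) &
      level a i.+1 <= maxn (level a' i) (inner_level a' f' i.+1)].
Proof.
move=> id; have id0 := ltnW id.
have [fa aa ar] := edge_bounds id0; have [fa1 aa1 ar1] := edge_bounds id.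
have /andP[b1 b2] := iright_bounds af id0; have /andP[b3 b4] := iright_bounds af' id0.
have /andP[b5 b6] := iright_bounds af id; have /andP[b7 b8] := iright_bounds af' id.
have G2 : gap_level a' f' i <= level a i.+1 by apply: split_levelS => //; lia.
split=> //.
- have [le|lt] := leqP (f i.+1) (a i.+1).
    by rewrite inner_level0.
  by apply: split_levelS => //; rewrite /iright; lia.
- have Mx := level_max af id0; have My := level_max af' id0.
  have := same_type id0; rewrite /left_type => st.
  have [lt|ge] := ltnP (inner_level a' f' i) (gap_level a' f' i); first lia.
  have ltaf : a i < f i.
    rewrite ltnNge; apply/negP => le; have := gap_level_gt0 af id0.
    by have := inner_level0 le; lia.
  rewrite /level /gap_level -split_level_max; try lia.
  by apply: split_levelS; rewrite ?/iright; lia.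
- rewrite -split_level_max; try lia.
  by apply: split_levelS; lia.
Qed.

Lemma ascent_edge i : i.+1 < d -> ascent a i -> 
  [/\ up_floor a f i <= level a' i, level a' i <= level a i.+1 &
      level a i.+1 <= maxn (level a' i) (up_floor a' f' i)].
Proof.
move=> id; have id0 := ltnW id; have [A1 A2 A3 A4] := level_edge id.
have := same_type id0; have := same_type id.
have := level_max af id0; have := level_max af' id0.
have := level_max af id; have := level_max af' id.
rewrite /up_floor /ascent /left_type.
by case: ifP; case: ifP; move=> *; split; lia.
Qed.

(** Read with reversed indices, these are the inequalities of an [iedge] from the primed to the
    unprimed vertex. *)
Lemma descent_edge i : i.+1 < d -> ~~ ascent a' i ->
  [/\ down_floor a' f' i <= level a i.+1, level a i.+1 <= level a' i &
      level a' i <= maxn (down_floor a f i) (level a i.+1)].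
Proof.
move=> id; have id0 := ltnW id; have [A1 A2 A3 A4] := level_edge id.
have := same_type id0; have := same_type id.
have := level_max af id0; have := level_max af' id0.
have := level_max af id; have := level_max af' id.
have := inner_level_neq af id; have := inner_level_neq af' id.
rewrite /down_floor /ascent /left_type.
by case: ifP; case: ifP; move=> *; split; lia.
Qed.

End ReducedEdge.

(** * Colouring the interval shift graph *)

Definition bits n (P : nat -> bool) : {ffun 'I_n -> bool} := [ffun i : 'I_n => P i].

Lemma bits_inj n P Q : bits n P = bits n Q -> forall i, i < n -> P i = Q i.
Proof.
move=> E i id; have := congr1 (fun g : {ffun _} => g (Ordinal id)) E.
by rewrite !ffunE.
Qed.

Lemma card_bits n : #|{ffun 'I_n -> bool}| = 2 ^ n.
Proof. by rewrite card_ffun card_bool card_ord. Qed.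

Section ReducedColoring.
Variables (d N l : nat) (C : finType).
Variable col : (nat -> nat) -> (nat -> nat) -> C.
Hypotheses (Nl : N <= 2 ^ l) (col_ok : icoloring d.+1 l.+1 col).

Definition all_ascents a := [forall i : 'I_d, ascent a i].
Definition all_descents a := [forall i : 'I_d, ~~ ascent a i].

(* Two consecutive comparisons of levels that disagree rule out an edge if    *)
(* they are up, then down; if they are down, then up, the two extra families  *)
(* of bits differ at the ends of an edge.                                     *)
Definition reduced_color a f : C + {ffun 'I_d -> bool} * {ffun 'I_d -> bool} :=
  if all_ascents a then inl (col (level a) (up_floor a f))
  else if all_descents a then
    inl (col (fun j => level a (d - j)) (fun j => down_floor a f (d.-1 - j)))
  else inr (bits d (fun i => down_floor a f i < level a i.+1),
            bits d (fun i => up_floor a f i < level a i)).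

Definition step_color a f :=
  (bits d.+1 (left_type a f), bits d (ascent a), reduced_color a f).

Lemma icoloring_step : icoloring d.+2 N step_color.
Proof.
move=> a f a' f' af af' e [/bits_inj st /bits_inj sa].
have asc i (id : i < d) := ascent_edge af af' e st (id : i.+1 < d.+1).
have desc i (id : i < d) := descent_edge af af' e st (id : i.+1 < d.+1).
have neq i (id : i < d.+1) := level_edge_neq af af' e st id.
have uf i (id : i < d) := up_floor_lt af (id : i.+1 < d.+1).
have uf' i (id : i < d) := up_floor_lt af' (id : i.+1 < d.+1).
have df i (id : i < d.+1) := down_floor_lt af id.
have df' i (id : i < d.+1) := down_floor_lt af' id.
have bd i (id : i < d.+1) := level_bound af Nl id.
have bd' i (id : i < d.+1) := level_bound af' Nl id.
have nq i (id : i < d) := level_neq af (id : i.+1 < d.+1).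
have nq' i (id : i < d) := level_neq af' (id : i.+1 < d.+1).
rewrite /reduced_color; have -> : all_ascents a = all_ascents a'.
  by apply: eq_forallb => i; apply: sa.
have -> : all_descents a = all_descents a'.
  by apply: eq_forallb => i; rewrite sa.
case: ifP => [/forallP up' | /negbT/forallPn[i0 d0]].
  have upi' i (id : i < d) : ascent a' i := up' (Ordinal id).
  have upi i (id : i < d) : ascent a i by rewrite sa ?upi'.
  move=> [] /col_ok; apply; first by split=> // i id; split; [exact: upi | exact: uf].
    by split=> // i id; split; [exact: upi' | exact: uf'].
  by split=> [|i id]; [exact: neq | exact/asc/upi].
case: ifP => [/forallP down' | /negbT/forallPn[i1 /negPn d1]].
  have downi' i (id : i < d) : ~~ ascent a' i := down' (Ordinal id).
  have downi i (id : i < d) : ~~ ascent a i by rewrite sa ?downi'.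
  have subE j : j.+1 < d.+1 -> d - j = (d.-1 - j).+1 by lia.
  have subE' j : d - j.+1 = d.-1 - j by lia.
  have lt1 j : j.+1 < d.+1 -> d.-1 - j < d by lia.
  (* Reading levels backwards turns descents into ascents and interchanges the ends of the edge,
     hence [esym E]. *)
  move=> [] E; apply: (@col_ok _ _ _ _ _ _ _ (esym E)); split.
  - by move=> j _; apply: bd'; lia.
  - move=> j jd; rewrite subE // subE'; split; last by apply: df'; apply: leqW; auto.
    by have := downi' _ (lt1 _ jd); have := nq' _ (lt1 _ jd); rewrite /ascent; lia.
  - by move=> j _; apply: bd; lia.
  - move=> j jd; rewrite subE // subE'; split; last by apply: df; apply: leqW; auto.
    by have := downi _ (lt1 _ jd); have := nq _ (lt1 _ jd); rewrite /ascent; lia.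
  - by rewrite subn0 => E2; apply: (neq d _ (esym E2)).
  - move=> j jd; rewrite subE // subE'.
    have [h1 h2 h3] := desc _ (lt1 _ jd) (downi' _ (lt1 _ jd)).
    by split=> //; rewrite maxnC.
move=> [] /bits_inj bl /bits_inj bu.
have [i id flip] : exists2 i, i.+1 < d & ascent a' i != ascent a' i.+1.
  case: (boolP [exists i : 'I_d.-1, ascent a' i != ascent a' i.+1]).
    by case/existsP=> i fl; exists i => //; have := ltn_ord i; lia.
  rewrite negb_exists => /forallP const.
  have as0 j : j < d -> ascent a' j = ascent a' 0.
    elim: j => [//|j IH] jd; rewrite -(IH (ltnW jd)).
    have jd' : j < d.-1 by lia.
    by have := const (Ordinal jd'); rewrite negbK => /eqP <-.
  by move: d0 d1; rewrite !as0 // => /negP.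
have id0 := ltnW id; have ids : i.+1 < d.+1 by lia.
case Ai: (ascent a' i) flip; case Aj: (ascent a' i.+1) => // _.
  (* Up, then down: the ascent at [i] forces [level a i.+1 < level a' i.+1], the descent at [i.+1]
     forces the reverse. *)
  have [_ _ h1] := asc i id0 (etrans (sa i id0) Ai).
  have [_ _ h2] := desc i.+1 id (negbT Aj).
  have := uf' i id0; have := df i.+1 ids; have := sa i.+1 id.
  by move: Ai Aj; rewrite /ascent; lia.
(* Down, then up: if [level a i.+1 < level a' i.+1], the [down_floor] bits at [i] differ; otherwise
   the [up_floor] bits at [i.+1] do. *)
have [h1 h2 h3] := desc i id0 (negbT Ai).
have [h4 h5 h6] := asc i.+1 id (etrans (sa i.+1 id) Aj).
have := bl i id0; have := bu i.+1 id; have := neq i.+1 ids.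
have := sa i id0; have := sa i.+1 id.
by move: Ai Aj; rewrite /ascent; lia.
Qed.

Lemma card_step_color :
  #|{: {ffun 'I_d.+1 -> bool} * {ffun 'I_d -> bool} *
      (C + {ffun 'I_d -> bool} * {ffun 'I_d -> bool})}| =
  2 ^ (d + d).+1 * (#|C| + 2 ^ (d + d)).
Proof.
by rewrite !card_prod card_sum card_prod !card_bits -!expnD addSn.
Qed.

End ReducedColoring.

(** For [l = (trunc_log 2 N).+1] the levels take the l + 1 values 0, ..., l. At [d = 0] the
    successor keeps the colour type ['I_N.+1] inhabited. *)
Fixpoint ibound d N :=
  if d is e.+1 then 2 ^ (e + e).+1 * (ibound e (trunc_log 2 N).+2 + 2 ^ (e + e))
  else N.+1.

Lemma icolorable d N : exists (C : finType)
  (col : (nat -> nat) -> (nat -> nat) -> C),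
  icoloring d.+1 N col /\ #|C| = ibound d N.
Proof.
elim: d N => [|d IHd] N.
  exists 'I_N.+1, (fun a _ => inord (a 0)); split; last by rewrite card_ord.
  move=> a f a' f' [af _] [af' _] [neq _].
  move/(congr1 (@nat_of_ord _)); rewrite !inordK //.
    exact: leqW (af' 0 isT).
  exact: leqW (af 0 isT).
have [C [col [col_ok cardC]]] := IHd (trunc_log 2 N).+2.
exists _, (@step_color d C col); split; last by rewrite card_step_color cardC.
by apply: icoloring_step col_ok; apply/ltnW/trunc_log_ltn.
Qed.

(** * Order types as pairs of masks *)

Definition in_first (a : nat) : bool := (a == 1) || (a == 3).
Definition in_second (a : nat) : bool := (a == 2) || (a == 3).

Lemma mem_masks (T : eqType) t (z : seq T) x :
    wf_entries t -> size z = size t -> x \in z ->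
  x \in mask (map in_first t) z \/ x \in mask (map in_second t) z.
Proof.
elim: t z => [|a t IH] [|y z] //= /andP[a3 wt] [sz]; rewrite !inE in a3 *.
case/predU1P => [->|/(IH z wt sz)]; case/or3P: a3 => /eqP -> /=;
  by rewrite ?inE ?eqxx; do ?[by left | by right | case=> ->; rewrite ?orbT].
Qed.

Section OrderType.
Context {disp : Order.disp_t} {T : orderType disp}.
Implicit Types X Y : {fset T}.

Lemma order_type_masks X Y : exists z : seq T,
  [/\ sorted <%O z, size z = size (order_type X Y),
      sort <=%O X = mask (map in_first (order_type X Y)) z &
      sort <=%O Y = mask (map in_second (order_type X Y)) z].
Proof.
set z := sort <=%O (X `|` Y)%fset.
have z_sort : sorted <%O z by rewrite sort_lt_sorted fset_uniq.
have eq_sort (W : {fset T}) : {subset W <= z} -> sort <=%O W = [seq x <- z | x \in W].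
  move=> sWz; apply: lt_sorted_eq; first by rewrite sort_lt_sorted fset_uniq.
    exact: lt_sorted_filter.
  by move=> x; rewrite mem_sort mem_filter; case: (boolP (x \in W)) => // /sWz ->.
exists z; rewrite /order_type -/z size_map -!map_comp !eq_sort.
- split=> //; rewrite filter_mask; congr mask; apply/eq_in_map => x;
    rewrite /= mem_sort in_fsetU; case: (x \in X) (x \in Y) => [] [] //.
- by move=> x xY; rewrite mem_sort in_fsetU xY orbT.
- by move=> x xX; rewrite mem_sort in_fsetU xX.
Qed.

Lemma order_typeE X Y (t : seq nat) (z : seq T) :
    wf_entries t -> sorted <%O z -> size z = size t ->
    X =i mask (map in_first t) z -> Y =i mask (map in_second t) z ->
  order_type X Y = t.
Proof.
move=> wf_t z_sort sz XE YE.
have zE : sort <=%O (X `|` Y)%fset = z.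
  apply: lt_sorted_eq; rewrite ?sort_lt_sorted ?fset_uniq // => x.
  rewrite mem_sort in_fsetU XE YE; apply/idP/idP.
    by case/orP; apply: mem_mask.
  by move=> xz; apply/orP; apply: mem_masks.
rewrite /order_type zE.
have u_z := lt_sorted_uniq z_sort.
have {zE z_sort} XE' x : x \in z -> (x \in X) = (x \in mask (map in_first t) z) by [].
have {XE} YE' x : x \in z -> (x \in Y) = (x \in mask (map in_second t) z) by [].
elim: t z wf_t sz u_z XE' {YE} YE' => [|a t IH] [|y z] //= /andP[a3 wt] [sz].
case/andP=> yz uz XE YE; congr (_ :: _).
  rewrite XE ?YE ?inE ?eqxx //; move: a3; rewrite !inE.
  have ny m : y \in mask m z = false by apply: contraNF yz; apply: mem_mask.
  by case/or3P => /eqP ->; rewrite /= ?inE ?eqxx ?ny.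
apply: IH => // x xz.
  rewrite XE ?inE ?xz ?orbT //; case: ifP => // _; rewrite inE.
  by case: eqP => // E; rewrite -E xz in yz.
rewrite YE ?inE ?xz ?orbT //; case: ifP => // _; rewrite inE.
by case: eqP => // E; rewrite -E xz in yz.
Qed.

Lemma order_typeC X Y : order_type Y X = map swap12 (order_type X Y).
Proof.
rewrite /order_type -map_comp [in RHS]fsetUC; apply/eq_in_map => x.
by rewrite mem_sort in_fsetU /=; case: (x \in X) (x \in Y) => [] [].
Qed.

End OrderType.

Lemma nth_mask_eq (z : seq nat) m p : size m = size z -> nth false m p ->
  nth 0 (mask m z) (count id (take p m)) = nth 0 z p.
Proof.
elim: m z p => [|b m' IH] [|x z'] [|p] //=.
  by case: b.
by move=> [sz] mp; case: b => //=; rewrite IH.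
Qed.

Lemma nth_mask_ge (z : seq nat) m p j :
    sorted ltn z -> size m = size z -> count id (take p m) <= j -> j < count id m ->
  nth 0 z p <= nth 0 (mask m z) j.
Proof.
move=> z_sort size_m pj jm; have {pj} : exists2 q, p <= q < size m & nth 0 (mask m z) j = nth 0 z q.
  elim: m z p j size_m pj jm {z_sort} => [|b m' IH] [|x z'] [|p] [|j] //= [sz].
  - move=> _; case: b => /= [_|jm]; first by exists 0.
    have [|q qm E] := IH z' 0 0 sz _ jm; first by rewrite take0.
    by exists q.+1.
  - move=> _; case: b => /= jm.
      have [|q qm E] := IH z' 0 j sz _ jm; first by rewrite take0.
      by exists q.+1.
    have [|q qm E] := IH z' 0 j.+1 sz _ jm; first by rewrite take0.
    by exists q.+1.
  - case: b => //= pj jm; have [q qm E] := IH z' p 0 sz pj jm.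
    by exists q.+1.
  - case: b => /= pj jm.
      by have [q qm E] := IH z' p j sz pj jm; exists q.+1.
    by have [q qm E] := IH z' p j.+1 sz pj jm; exists q.+1.
case=> q /andP[pq qm] ->; move: pq; rewrite leq_eqVlt => /predU1P[-> //|pq].
apply/ltnW/(sorted_ltn_nth ltn_trans) => //; rewrite inE -size_m //.
exact: ltn_trans qm.
Qed.

Lemma nth_mask_lt (z : seq nat) m p j :
    sorted ltn z -> size m = size z -> p < size m -> j < count id (take p m) ->
  nth 0 (mask m z) j < nth 0 z p.
Proof.
move=> z_sort size_m pm jp; have [q qp ->] : exists2 q, q < p & nth 0 (mask m z) j = nth 0 z q.
  elim: m z p j size_m pm jp {z_sort} => [|b m' IH] [|x z'] [|p] [|j] //= [sz] pm.
  - case: b => /= jp; first by exists 0.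
    by have [q qm E] := IH z' p 0 sz pm jp; exists q.+1.
  - case: b => /= jp.
      by have [q qm E] := IH z' p j sz pm jp; exists q.+1.
    by have [q qm E] := IH z' p j.+1 sz pm jp; exists q.+1.
apply: (sorted_ltn_nth ltn_trans) => //; rewrite inE -size_m //.
exact: ltn_trans pm.
Qed.

Lemma mask_index m q : q < count id m ->
  exists2 p, nth false m p & count id (take p m) = q.
Proof.
elim: m q => [|b m' IH] q //=; case: b q => [] [|q] //= qm.
- by exists 0.
- by have [p mp E] := IH q qm; exists p.+1; rewrite //= E.
- by have [p mp E] := IH 0 qm; exists p.+1; rewrite //= E.
- by have [p mp E] := IH q.+1 qm; exists p.+1; rewrite //= E.
Qed.

Lemma ones_first t : ones t = count id (map in_first t).
Proof. by rewrite count_map. Qed.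

Lemma twos_second t : twos t = count id (map in_second t).
Proof. by rewrite count_map. Qed.

(** * Blocks of a primary type and parts of a set *)

(** A following entry 1 could join the block without changing [twos], against maximality. *)
Lemma block_length_head m s : m <= twos s -> head 0 (drop (block_length m s) s) != 1.
Proof.
move=> ms; have tw := block_length_twos ms; apply/negP => /eqP hd.
have lt : block_length m s < size s.
  by rewrite ltnNge; apply/negP => le; rewrite drop_oversize in hd.
have tw' : twos (take (block_length m s).+1 s) == m.
  rewrite -nth0 nth_drop addn0 in hd.
  by rewrite (take_nth 0) // -cats1 twos_cat tw hd /twos /= !addn0.
have : (block_length m s).+1 <= block_length m s.
  have lt' : (block_length m s).+1 < (size s).+1 by [].
  exact: (@leq_bigmax_cond _ [pred j : 'I_(size s).+1 | twos (take j s) == m]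
            (fun j => j : nat) (Ordinal lt')).
by rewrite ltnn.
Qed.

Lemma next_blocks_head f B s i :
    flatten (next_blocks f (ones B) s) = s ->
    path (fun C C' => twos C' == ones C) B (next_blocks f (ones B) s) ->
    0 < i <= size (next_blocks f (ones B) s) ->
  head 0 (flatten (drop i (next_blocks f (ones B) s))) != 1.
Proof.
elim: f B s i => [|f IH] B [|a s] [|i] //=; set s' := a :: s.
move=> fE /andP[/eqP tw pth] ile.
have {}fE : flatten (next_blocks f (ones (take (block_length (ones B) s') s'))
   (drop (block_length (ones B) s') s')) = drop (block_length (ones B) s') s'.
  by move: fE; rewrite -[X in _ = X -> _](cat_take_drop (block_length (ones B) s'));
    move/eqP; rewrite eqseq_cat // => /andP[_ /eqP].
case: i ile => [_|i ile]; last first.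
  exact: (IH _ _ i.+1 fE pth).
rewrite ?drop0 fE; apply: block_length_head; rewrite -tw.
by rewrite -[X in _ <= twos X](cat_take_drop (block_length (ones B) s')) twos_cat leq_addr.
Qed.

Lemma next_blocks_tail f m s i : flatten (next_blocks f m s) = s ->
  i < size (next_blocks f m s) -> flatten (drop i (next_blocks f m s)) <> [::].
Proof.
elim: f m s i => [|f IH] m [|a s] [|i] //=; set s' := a :: s; first by move->.
move=> fE; apply: IH; move: fE.
rewrite -[X in _ = X -> _](cat_take_drop (block_length m s')).
by move/eqP; rewrite eqseq_cat // => /andP[_ /eqP].
Qed.

(** The excess of ones over twos starts at 1, changes by at most one per entry, and cannot vanish
    before the end by [irreducible_prefix]. *)
Lemma primary_prefix k t j : is_type_of_width k t -> irreducible_type t ->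
  head 0 t = 1 -> 0 < j < size t -> twos (take j t) < ones (take j t).
Proof.
move=> kt irr hd; elim: j => [|[|j] IH] // /andP[_ jt].
  by case: t hd jt {kt irr IH} => [|a t] //= ->; rewrite take0.
have {}IH := IH (ltnW jt); have := irreducible_prefix kt irr (jt : 0 < j.+2 < _).
rewrite (take_nth 0 (ltnW jt)) -cats1 twos_cat ones_cat.
rewrite -![twos [:: _]]/(nat_of_bool _ + 0) -![ones [:: _]]/(nat_of_bool _ + 0) !addn0.
by case: (_ || _); case: (_ || _); lia.
Qed.

Section Cuts.
Variables (k : nat) (t : seq nat).
Hypotheses (kt : is_type_of_width k t) (irr : irreducible_type t).
Hypothesis hd : head 0 t = 1.

Let bs := primary_blocks t.

(** Blocks are counted from 0: part [i] of the first set fills block [i], and by [cut_twos] part [i]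
    of the second set fills block [i.+1], which starts at [cut i.+1]. *)
Definition cut i := size (flatten (take i (primary_blocks t))).
Definition cut_ones i := ones (flatten (take i (primary_blocks t))).

Lemma cat_cut i : t = flatten (take i bs) ++ flatten (drop i bs).
Proof.
by rewrite -flatten_cat cat_take_drop; have [->] := primary_blocksP kt irr hd.
Qed.

Lemma take_cut i : take (cut i) t = flatten (take i bs).
Proof. by rewrite {1}(cat_cut i) take_size_cat. Qed.

Lemma drop_cut i : drop (cut i) t = flatten (drop i bs).
Proof. by rewrite {1}(cat_cut i) drop_size_cat. Qed.

Lemma cut_head i : 0 < i <= size bs -> head 0 (drop (cut i) t) != 1.
Proof.
rewrite drop_cut; have [] := primary_blocksP kt irr hd.
rewrite /bs /primary_blocks; set j := find _ t; case: i => [//|i] /=.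
move=> fE pth _ ile.
have {}fE : flatten (next_blocks (size t) (ones (take j t)) (drop j t)) = drop j t.
  by move: fE; rewrite -[X in _ = X -> _](cat_take_drop j);
    move/eqP; rewrite eqseq_cat // => /andP[_ /eqP].
case: i ile => [_|i ile]; last exact: next_blocks_head.
rewrite ?drop0 fE -nth0 nth_drop addn0.
have [jt|jt] := ltnP j (size t); last by rewrite nth_default.
by have := nth_find 0 (_ : has (predC (pred1 1)) t); rewrite has_find => /(_ jt).
Qed.

Lemma cut_twos i : i < size bs -> twos (flatten (take i.+1 bs)) = cut_ones i.
Proof.
have [_ + _] := primary_blocksP kt irr hd; rewrite /cut_ones -/bs.
have twos1 : twos (head [::] bs) = 0.
  rewrite /bs /= /twos; apply/eqP; rewrite -leqn0 leqNgt -has_count.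
  apply/hasPn => a; set j := find _ t => aj.
  have : all (pred1 1) (take j t).
    by rewrite -(negbK (all _ _)) -has_predC has_take_leq ?find_size // ltnn.
  by move/allP/(_ _ aj) => /eqP ->.
elim: i => [|i IH] srt ib.
  by rewrite take0; case: (bs) twos1 => [|B s] //=; rewrite take0 cats0.
rewrite (take_nth [::] ib) flatten_rcons twos_cat IH ?(ltnW ib) //.
rewrite (take_nth [::] (ltnW ib)) flatten_rcons ones_cat; congr addn.
by apply/eqP; have /sortedP-/(_ [::] i ib) := srt.
Qed.

Lemma cut_gt0 i : 0 < i -> 0 < cut i.
Proof.
case: i => // i _; rewrite /cut /= size_cat ltn_addr // lt0n size_eq0.
by case: t hd => //= a s ->.
Qed.

Lemma cut_lt i : i < size bs -> cut i < size t.
Proof.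
move=> ib; rewrite ltnNge; apply/negP => le.
have [fE _ _] := primary_blocksP kt irr hd.
have := drop_oversize le; rewrite drop_cut; move: fE ib.
rewrite /bs /primary_blocks; set j := find _ t; case: i le => [|i] le /=.
  by move: le; rewrite /cut take0 leqn0 size_eq0 => /eqP t0; move: hd; rewrite t0.
move=> fE ib; apply: next_blocks_tail ib.
move: fE; rewrite -[X in _ = X -> _](cat_take_drop j).
by move/eqP; rewrite eqseq_cat // => /andP[_ /eqP]; apply.
Qed.

Lemma cut_onesE i : cut_ones i = ones (take (cut i) t).
Proof. by rewrite take_cut. Qed.

Lemma cut_twosE i : i < size bs -> twos (take (cut i.+1) t) = cut_ones i.
Proof. by rewrite take_cut; apply: cut_twos. Qed.

Lemma cut_ones_ltS i : i.+1 < size bs -> cut_ones i < cut_ones i.+1.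
Proof.
move=> ib; rewrite -cut_twosE ?(ltnW ib) // cut_onesE.
by apply: (primary_prefix kt) => //; rewrite cut_gt0 // cut_lt.
Qed.

Lemma cut_ones_lt i : i.+1 < size bs -> cut_ones i < k.
Proof.
move=> ib; have [_ <- _] := (is_type_of_widthE k t).1 kt.
apply: leq_trans (cut_ones_ltS ib) _; rewrite cut_onesE.
by rewrite -[X in _ <= ones X](cat_take_drop (cut i.+1)) ones_cat leq_addr.
Qed.

End Cuts.

(* The vertex of the interval shift graph attached to a set with increasing   *)
(* enumeration xs: the first and the last elements of its parts, the part     *)
(* number i having as many elements as there are ones in block number i.      *)
Definition part_first t (xs : seq nat) i := nth 0 xs (cut_ones t i).
Definition part_last t (xs : seq nat) i := nth 0 xs (cut_ones t i.+1).-1.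

Section PartVertex.
Variables (k d : nat) (t : seq nat).
Hypotheses (kt : is_type_of_width k t) (irr : irreducible_type t).
Hypotheses (hd : head 0 t = 1) (size_bs : size (primary_blocks t) = d.+2).

Lemma part_ivertex n xs : sorted ltn xs -> size xs = k -> all (gtn n) xs ->
  ivertex d.+1 n (part_first t xs) (part_last t xs).
Proof.
move=> srt sx ltn_xs; have lt i : i.+1 < d.+2 -> cut_ones t i < size xs.
  by move=> id; rewrite sx; apply: (cut_ones_lt kt) => //; rewrite size_bs.
have ltS i : i.+1 < d.+2 -> cut_ones t i < cut_ones t i.+1.
  by move=> id; apply: (cut_ones_ltS kt) => //; rewrite size_bs.
split=> [i id|i id]; first exact/(allP ltn_xs)/mem_nth/lt.
have ltn_i := ltS i (ltnW id : i.+1 < d.+2); have lti := lt i.+1 id.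
split; apply: (sorted_ltn_nth ltn_trans) => //; rewrite ?inE.
- exact: ltn_trans lti.
- exact: leq_ltn_trans (leq_pred _) lti.
- by rewrite ltn_predL; apply: leq_trans ltn_i.
Qed.

(** Position [cut t i.+1] separates part [i] of [xs] from part [i] of [ys]. Its entry is not 1, so
    it holds the first element of the latter, whence the middle inequality. The last one follows
    from [primary_prefix] at the position of the first element of part [i.+1] of [xs]. *)
Lemma part_iedge z xs ys : sorted ltn z -> size z = size t ->
    xs = mask (map in_first t) z -> ys = mask (map in_second t) z ->
  iedge d.+1 (part_first t xs) (part_last t xs)
    (part_first t ys) (part_last t ys).
Proof.
move=> srt sz -> ->.
have sz1 : size (map in_first t) = size z by rewrite size_map.
have sz2 : size (map in_second t) = size z by rewrite size_map.
have [wf t1 t2] := (is_type_of_widthE k t).1 kt.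
have c1 i : count id (take i (map in_first t)) = ones (take i t).
  by rewrite -map_take ones_first.
have c2 i : count id (take i (map in_second t)) = twos (take i t).
  by rewrite -map_take twos_second.
have k1 : count id (map in_first t) = k by rewrite -ones_first.
have k2 : count id (map in_second t) = k by rewrite -twos_second.
have cltp i : i < d.+2 -> cut t i < size t.
  by move=> id; apply: (cut_lt kt) => //; rewrite size_bs.
have clt i : i < d.+2 -> cut t i < size (map in_first t).
  by rewrite size_map; apply: cltp.
have ltk i : i.+1 < d.+2 -> cut_ones t i < k.
  by move=> id; apply: (cut_ones_lt kt) => //; rewrite size_bs.
have ltS i : i.+1 < d.+2 -> cut_ones t i < cut_ones t i.+1.
  by move=> id; apply: (cut_ones_ltS kt) => //; rewrite size_bs.
have lt_first i : i < d.+1 ->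
    part_last t (mask (map in_first t) z) i < nth 0 z (cut t i.+1).
  move=> id; apply: nth_mask_lt => //; first exact: clt.
  rewrite c1 -(cut_onesE kt) // ltn_predL.
  exact: leq_ltn_trans (leq0n _) (ltS i id).
have ge_second i : i < d.+1 ->
    nth 0 z (cut t i.+1) <= part_first t (mask (map in_second t) z) i.
  move=> id; apply: nth_mask_ge => //; last by rewrite k2 ltk.
  by rewrite c2 (cut_twosE kt) // size_bs ltnW.
split.
  apply/eqP; rewrite ltn_eqF //; apply: leq_trans (ge_second 0 isT).
  apply: nth_mask_lt => //; first exact: clt.
  by rewrite c1 -(cut_onesE kt) // (ltS 0).
move=> i ltid; split.
- exact/ltnW/(leq_trans (lt_first i (ltnW ltid)))/ge_second/ltnW.
- rewrite {1}/part_first -(cut_twosE kt) // -?c2 ?size_bs; last exact/leqW/ltnW.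
  rewrite nth_mask_eq //.
    apply: nth_mask_ge => //; last by rewrite k1 ltk.
    by rewrite c1 (cut_onesE kt).
  rewrite (nth_map 0) ?cltp //; last exact: ltnW.
  have := cut_head kt irr hd (i := i.+1); rewrite size_bs => /(_ (ltnW (ltnW ltid))).
  rewrite -nth0 nth_drop addn0.
  have := allP wf _ (mem_nth 0 (cltp i.+1 (ltnW ltid))).
  by rewrite !inE /in_second => /or3P[] /eqP ->.
rewrite leq_max; apply/orP; right.
have : cut_ones t i.+1 < count id (map in_first t) by rewrite k1 ltk.
case/mask_index => p mp pE; rewrite {1}/part_first -pE nth_mask_eq //.
have lt_pt : p < size t.
  rewrite ltnNge; apply/negP => le; move: mp.
  by rewrite nth_default // size_map.
have ci : 0 < cut_ones t i.+1.
  exact: leq_ltn_trans (leq0n _) (ltS i (leqW ltid)).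
have p_gt0 : 0 < p by move: ci; rewrite -pE; case: (p) => //; rewrite take0.
apply: nth_mask_ge => //.
  rewrite c2 -ltnS prednK //; apply: leq_trans (primary_prefix kt irr hd _) _.
    by rewrite p_gt0.
  by rewrite -c1 pE.
rewrite k2; exact: leq_ltn_trans (leq_pred _) (ltk i.+1 ltid).
Qed.

End PartVertex.

(** * The upper bound for primary types *)

Definition elements n (U : {set 'I_n}) : seq nat :=
  map val (sort <=%O [fset i in U]%fset).

Lemma elements_sorted n (U : {set 'I_n}) : sorted ltn (elements U).
Proof.
rewrite /elements sorted_map; apply: (sub_sorted (e := <%O)) => [i j|].
  by rewrite ltEord.
by rewrite sort_lt_sorted fset_uniq.
Qed.

Lemma size_elements n (U : {set 'I_n}) : size (elements U) = #|U|.
Proof.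
rewrite size_map size_sort cardE; apply: perm_size; apply: uniq_perm.
- exact: fset_uniq.
- exact: enum_uniq.
by move=> i; rewrite mem_enum in_fset.
Qed.

Lemma elements_ltn n (U : {set 'I_n}) : all (gtn n) (elements U).
Proof. by apply/allP => _ /mapP[i _ ->] /=. Qed.

Lemma colorable_finType (T C : finType) (e : rel T) (f : T -> C) :
  (forall x y, e x y -> f x <> f y) -> colorable e #|C|.
Proof.
move=> f_ok; apply/existsP; exists [ffun x => enum_rank (f x)].
apply/forallP => x; apply/forallP => y; apply/implyP => /f_ok fxy.
by rewrite !ffunE; apply/eqP => /enum_rank_inj.
Qed.

Section Primary.
Variables (k d : nat) (t : seq nat).
Hypotheses (kt : is_type_of_width k t) (irr : irreducible_type t).
Hypotheses (hd : head 0 t = 1) (size_bs : size (primary_blocks t) = d.+2).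

Lemma order_type_iedge n (U V : {set 'I_n}) :
    order_type [fset i in U]%fset [fset i in V]%fset = t ->
  iedge d.+1 (part_first t (elements U)) (part_last t (elements U))
    (part_first t (elements V)) (part_last t (elements V)).
Proof.
move=> tE; have [z [z_srt sz XE YE]] := order_type_masks [fset i in U]%fset [fset i in V]%fset.
rewrite tE in sz XE YE; apply: (part_iedge kt irr hd size_bs (z := map val z)).
- by rewrite sorted_map; apply: sub_sorted z_srt => i j; rewrite ltEord.
- by rewrite size_map.
- by rewrite /elements XE map_mask.
- by rewrite /elements YE map_mask.
Qed.

Lemma nontrivial_primary : ~~ trivial_type t.
Proof. by rewrite /trivial_type; case: t hd => //= a s ->. Qed.

Lemma chromatic_number_le n :
  chromatic_number (@type_graph n k t) <= ibound d n.
Proof.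
have [C [col [col_ok <-]]] := icolorable d n.
have [_] := chromatic_numberP (type_graph_irrefl (n := n) (k := k) nontrivial_primary).
apply; apply: (colorable_finType (f := fun X : ksubset n k =>
  col (part_first t (elements (val X))) (part_last t (elements (val X))))) => X Y.
have iv (Z : ksubset n k) : ivertex d.+1 n (part_first t (elements (val Z)))
    (part_last t (elements (val Z))).
  apply: (part_ivertex kt irr hd size_bs); rewrite ?elements_sorted ?elements_ltn //.
  by rewrite size_elements; apply/eqP/(valP Z).
by case/orP => /eqP /order_type_iedge e E; [|move/esym in E]; apply: col_ok e E.
Qed.

End Primary.

(** * Interchanging ones and twos *)

Lemma swap12K : involutive swap12.
Proof. by case=> [|[|[|]]]. Qed.

Lemma is_type_of_width_swap k t :
  is_type_of_width k t -> is_type_of_width k (map swap12 t).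
Proof.
case=> X [Y [cX cY tE]]; exists Y, X; split=> //.
by rewrite order_typeC tE.
Qed.

Lemma irreducible_type_swap t :
  irreducible_type t -> irreducible_type (map swap12 t).
Proof.
move=> [t0 irr]; split; first by case: (t) t0.
move=> t1 t2 [k1 T1] [k2 T2] n1 n2 E.
apply: (irr (map swap12 t1) (map swap12 t2)).
- by exists k1; apply: is_type_of_width_swap.
- by exists k2; apply: is_type_of_width_swap.
- by case: (t1) n1.
- by case: (t2) n2.
- by rewrite -map_cat -E (mapK swap12K).
Qed.

Lemma type_graph_swap n k t :
  @type_graph n k (map swap12 t) = @type_graph n k t.
Proof.
have eq_swap (s : seq nat) : (map swap12 s == map swap12 t) = (s == t).
  exact/inj_eq/inj_map/inv_inj/swap12K.
apply/funext => X; apply/funext => Y; rewrite /type_graph orbC.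
by congr (_ || _); rewrite order_typeC eq_swap.
Qed.

(* Interchanging ones and twos changes neither the type-graph nor the number  *)
(* of blocks, so that only primary types have to be considered.               *)
Lemma primary_reduction k t : is_type_of_width k t -> ~~ trivial_type t ->
    irreducible_type t -> exists t',
  [/\ is_type_of_width k t', irreducible_type t', head 0 t' = 1,
      size (primary_blocks t') = size (blocks t) &
      forall n, @type_graph n k t' = @type_graph n k t].
Proof.
move=> kt nt irr; case hd: (head 0 t == 1).
  by exists t; split=> //; [apply/eqP | rewrite /blocks hd].
exists (map swap12 t); split.
- exact: is_type_of_width_swap.
- exact: irreducible_type_swap.
(* A leading 3 would be a balanced proper prefix or, if alone, a trivial type. *)
- have [wf _ _] := (is_type_of_widthE k t).1 kt; case: (irr) => t0 _.
  have := @irreducible_prefix k t 1 kt irr.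
  case: t t0 nt hd wf {kt irr} => [|a [|a' s]] // _ nt hd /andP[a3 _];
    rewrite !inE in a3; case/or3P: a3 nt hd => /eqP -> //= _ _.
  by move=> /(_ isT).
- by rewrite /blocks hd size_map.
- by move=> n; apply: type_graph_swap.
Qed.

(** * Colourings of shift graphs *)

(** Colouring [s] by the set of colours of its extensions [w :: s] is again proper and costs one
    exponential: if the sets of [belast x s] and [s] agreed, [g (x :: s)] would equal some
    [g (w :: belast x s)], against [g_ok] for [w :: x :: s]. *)
Lemma shift_graph_coloring d m (C : finType) (g : seq nat -> C) :
    (forall x s, size s = d.+1 -> sorted ltn (x :: s) -> all (gtn m) (x :: s) ->
       g (belast x s) <> g s) ->
  m <= iter d (expn 2) #|C|.
Proof.
elim: d C g => [|d IH] C g g_ok.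
  have g_inj : injective (fun i : 'I_m => g [:: val i]).
    move=> i j E; apply/val_inj; case: (ltngtP (val i) (val j)) => // lt.
      by case: (g_ok i [:: val j]); rewrite //= ?lt ?ltn_ord.
    by case: (g_ok j [:: val i]); rewrite //= ?lt ?ltn_ord.
  by rewrite -[m]card_ord; apply: leq_card g_inj.
have card_set : #|{: {set C}}| = 2 ^ #|C|.
  rewrite -cardsT -card_powerset; apply: eq_card => A.
  by rewrite !finset.inE finset.subsetT.
rewrite iterSr -card_set.
pose g' s := [set g (val w :: s) | w : 'I_m & sorted ltn (val w :: s)].
apply: (IH _ g') => x s sz srt lt_m E.
have : g (x :: s) \in g' s.
  have xm : x < m by case/andP: lt_m.
  by apply/imsetP; exists (Ordinal xm); rewrite ?inE.
rewrite -E => /imsetP[w]; rewrite inE => w_srt E'.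
apply: (g_ok w (x :: s)); rewrite //= ?sz // ?ltn_ord //.
by case: s sz srt w_srt {lt_m E E'} => //= y s _ -> /andP[-> _].
Qed.

(** * Realising a type by translated point sets *)

Section Realization.
Local Open Scope ring_scope.

Lemma path_bounds (lo hi : rat) z : path <%O lo (rcons z hi) ->
  sorted <%O z /\ {in z, forall q, lo < q < hi}.
Proof.
rewrite (path_sortedE lt_trans) (sorted_pairwise lt_trans) -cats1 all_cat.
rewrite pairwise_cat -(sorted_pairwise lt_trans).
case/andP=> /andP[/allP lo_z _] /and3P[/allrelP z_hi z_srt _]; split=> // q qz.
by rewrite lo_z // z_hi // mem_head.
Qed.

(** Entries of [B] in the second set consume the given points; every other entry inserts a midpoint
    before the next one. *)
Lemma extend_word (lo hi : rat) B u : path <%O lo (rcons u hi) ->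
    twos B = size u ->
  exists z, [/\ path <%O lo (rcons z hi), size z = size B &
    mask (map in_second B) z = u].
Proof.
elim: B lo u => [|a B IH] lo u pu.
  by rewrite /twos /= => /esym/size0nil E; exists [::]; rewrite E in pu *.
rewrite /twos /= -/(twos B) -/(in_second a); case a2: (in_second a).
  case: u pu => [|x u] //= /andP[lox pu] [tw].
  have [z [pz sz mz]] := IH x u pu tw.
  by exists (x :: z); rewrite /= lox pz sz mz.
rewrite ?add0n => tw.
pose y := (lo + head hi u) / 2%:R.
have lo_hd : lo < head hi u by case: u {tw y} pu => [|x u] /= /andP[].
have [loy yhd] : lo < y /\ y < head hi u by rewrite /y !midf_lt.
have py : path <%O y (rcons u hi).
  by case: u {tw lo_hd loy} @y yhd pu => [|x u] /= yhd; rewrite yhd // => /andP[_].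
have [z [pz sz mz]] := IH y u py tw.
by exists (y :: z); rewrite /= loy pz sz mz.
Qed.

(* The points of the sets ss`_0, ss`_1, ... of fine positions, placed at the  *)
(* coarse positions xs`_0, xs`_1, ...; the longer list is truncated.          *)
Definition place (xs : seq nat) (ss : seq (seq rat)) : seq rat :=
  flatten [seq [seq p.1%:R + q | q <- p.2] | p <- zip xs ss].

Lemma place_cons x xs s ss :
  place (x :: xs) (s :: ss) = [seq x%:R + q | q <- s] ++ place xs ss.
Proof. by []. Qed.

(** Each [z] extends the previous set, its [in_second] points, and its [in_first] points form the
    next set. With [u] empty, the second mask uses the same sets [ss] as the first, shifted by one
    coarse position. *)
Lemma realize_blocks B bs u :
    path (fun C C' => twos C' == ones C) B bs ->
    path <%O 0 (rcons u 1) -> size u = ones B ->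
  exists zs ss : seq (seq rat),
    [/\ all (fun z => path <%O 0 (rcons z 1)) zs, size zs = size bs,
        map size ss = map ones bs &
        forall xs, size xs = size bs ->
          [/\ size (place xs zs) = size (flatten bs),
              mask (map in_first (flatten bs)) (place xs zs) = place xs ss &
              mask (map in_second (flatten bs)) (place xs zs) =
                place xs (u :: ss)]].
Proof.
elim: bs B u => [|B' bs IH] B u /=.
  by exists [::], [::]; split=> // -[].
case/andP=> /eqP tw pth pu su.
have [z [pz sz mz]] := extend_word pu (etrans tw (esym su)).
have pu' : path <%O 0 (rcons (mask (map in_first B') z) 1).
  apply: subseq_path pz; first exact: lt_trans.
  by rewrite -!cats1 cat_subseq ?mask_subseq.
have su' : size (mask (map in_first B') z) = ones B'.
  by rewrite size_mask ?size_map // ones_first.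
have [zs [ss [Hzs szs sss F]]] := IH B' _ pth pu' su'.
exists (z :: zs), (mask (map in_first B') z :: ss); split=> //=.
- by rewrite pz.
- by rewrite szs.
- by rewrite sss su'.
case=> [|x xs] // [sx]; have [F1 F2 F3] := F xs sx.
rewrite !place_cons !size_cat size_map F1 sz !map_cat !mask_cat ?size_map //.
by rewrite -!map_mask F2 F3 mz.
Qed.

Lemma place_ge x xs zs : path ltn x xs ->
    all (fun z => path <%O (0 : rat) (rcons z 1)) zs ->
  all (fun q => x.+1%:R <= q) (place xs zs).
Proof.
elim: xs zs x => [|y xs IH] [|z zs] x //= /andP[xy pxs] /andP[pz pzs].
rewrite place_cons all_cat; apply/andP; split; last first.
  apply/allP => q /(allP (IH _ _ pxs pzs)); apply: le_trans.
  by rewrite ler_nat ltnS ltnW.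
apply/allP => _ /mapP[q qz ->].
have [_ /(_ q qz)/andP[q0 _]] := path_bounds pz.
by apply: le_trans (_ : y%:R <= _); rewrite ?ler_nat // lerDl ltW.
Qed.

Lemma place_sorted xs zs : sorted ltn xs ->
    all (fun z => path <%O (0 : rat) (rcons z 1)) zs ->
  sorted <%O (place xs zs).
Proof.
elim: xs zs => [|x xs IH] [|z zs] // pxs /andP[pz pzs].
rewrite place_cons (sorted_pairwise lt_trans) pairwise_cat.
rewrite -!(sorted_pairwise lt_trans) IH ?(path_sorted pxs) // andbT.
have [z_srt z01] := path_bounds pz; apply/andP; split; last first.
  by rewrite sorted_map; apply: sub_sorted z_srt => p q; rewrite /= ltrD2l.
apply/allrelP => _ q /mapP[p pz' ->] /(allP (place_ge pxs pzs)).
by apply: lt_le_trans; rewrite -natr1 ltrD2l; case/andP: (z01 p pz').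
Qed.

Lemma place_rcons0 xs y ss : size ss = (size xs).+1 -> size (last [::] ss) = 0 ->
  place (rcons xs y) ss = place xs ss.
Proof.
case/lastP: ss => // ss s; rewrite size_rcons last_rcons => -[sz] /size0nil ->.
have zE : zip xs (rcons ss [::]) = zip xs ss.
  by rewrite -[in LHS](cats0 xs) -cats1 zip_cat // cats0.
by rewrite /place zE zip_rcons // map_rcons flatten_rcons cats0.
Qed.

Lemma mem_place (m : nat) xs ss : all (gtn m) xs ->
  {subset place xs ss <= [seq x%:R + q | x <- iota 0 m, q <- flatten ss]}.
Proof.
elim: xs ss => [|x xs IH] [|s ss] // /andP[xm xsm] r.
rewrite place_cons mem_cat => /orP[/mapP[q qs ->]|/(IH _ xsm)].
  by apply: allpairs_f; rewrite ?mem_iota //= mem_cat qs.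
case/allpairsP=> -[y q] [/= ym qss ->]; apply: allpairs_f => //.
by rewrite mem_cat qss orbT.
Qed.

End Realization.

(** * Mapping the shift graph into the type-graph *)

Section CountBelow.
Local Open Scope ring_scope.
Variable P : seq rat.

Definition count_below (q : rat) : nat := count (fun p => p < q) P.

Lemma count_below_lt p q : p \in P -> p < q -> (count_below p < count_below q)%N.
Proof.
move=> + pq; have sub x : x < p -> x < q by move/lt_trans; apply.
rewrite /count_below; elim: P => [|x s IH] //=.
rewrite inE => /predU1P[<-|/IH lt]; first by rewrite ltxx pq ltnS sub_count.
by rewrite -addnS leq_add //; case: (x < p) (sub x) => // ->.
Qed.

Lemma count_below_size p : p \in P -> (count_below p < size P)%N.
Proof.
move=> pP; rewrite ltn_neqAle count_size andbT -all_count.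
by apply/negP => /allP/(_ p pP); rewrite ltxx.
Qed.

End CountBelow.

Lemma map_val_ord n (s : seq nat) : all (gtn n) s ->
  exists z : seq 'I_n, map val z = s.
Proof.
elim: s => [|x s IH] /=; first by exists [::].
by case/andP=> xn /IH[z <-]; exists (Ordinal xn :: z).
Qed.

Section LowerBound.
Variables (k d : nat) (t : seq nat).
Hypotheses (kt : is_type_of_width k t) (irr : irreducible_type t).
Hypotheses (hd : head 0 t = 1) (size_bs : size (primary_blocks t) = d.+2).

Let bs := primary_blocks t.

Lemma blocks_path : path (fun C C' => twos C' == ones C) [::] bs.
Proof.
have [_ + _] := primary_blocksP kt irr hd; have := cut_twos kt irr hd (i := 0).
rewrite /cut_ones -/bs size_bs => /(_ isT).
by case: (bs) => //= B s; rewrite !take0 cats0 => ->.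
Qed.

Lemma last_block_ones : ones (last [::] bs) = 0.
Proof.
have [tE _ _] := primary_blocksP kt irr hd.
have [_ t1 t2] := (is_type_of_widthE k t).1 kt.
have := cut_twos kt irr hd (i := d.+1); rewrite size_bs => /(_ (leqnn _)).
rewrite take_oversize ?size_bs // tE t2 /cut_ones -t1 -[in ones t]tE -/bs.
have : size bs = d.+2 by [].
case/lastP: (bs) => // ss s; rewrite size_rcons last_rcons => -[sz].
by rewrite -cats1 take_cat sz ltnn subnn cats0 flatten_cat ones_cat /= cats0; lia.
Qed.

Lemma shift_graph_hom n m (C : finType) (f : ksubset n k -> C) :
    m * k <= n -> (forall X Y, type_graph t X Y -> f X <> f Y) ->
  m <= iter d (expn 2) #|C|.+1.
Proof.
move=> mkn f_ok; have [tE _ _] := primary_blocksP kt irr hd.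
have [wf t1 t2] := (is_type_of_widthE k t).1 kt.
have [||zs [ss [zs01 szs sss F]]] := realize_blocks blocks_path (u := [::]) => //.
have {}F xs : size xs = d.+2 ->
  [/\ size (place xs zs) = size t,
     mask (map in_first t) (place xs zs) = place xs ss &
     mask (map in_second t) (place xs zs) = place xs ([::] :: ss)].
  by move=> sx; have [] := F xs; rewrite ?size_bs // tE.
(* All points that tuples below [m] can produce: ranking inside one common [P] makes the vertex of a
   tuple independent of the edge considered. *)
pose P : seq rat := [seq x%:R%R + q | x <- iota 0 m, q <- flatten ss]%R.
have sP : size P = m * k.
  rewrite size_allpairs size_iota size_flatten /shape sss; congr (_ * _).
  rewrite -t1 -[in RHS]tE -/bs; elim: (bs) => //= B s ->.
  by rewrite ones_cat.
pose U xs : {set 'I_n} := [set i : 'I_n | val i \in map (count_below P) (place xs ss)]%SET.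
(* For an arbitrary list [xs] the set [U xs] may fail to have [k] elements, hence the additional
   colour [None]. *)
pose g xs := omap f (insub (U xs)).
rewrite -card_option; apply: (shift_graph_coloring (g := g)) => x s sz srt lt_m.
have [F1 F2 F3] := F (x :: s) (congr1 S sz).
have [ss_size ss_last] : size ss = d.+2 /\ size (last [::] ss) = 0.
  have sE : size ss = size bs by rewrite -(size_map size ss) sss size_map.
  split; first by rewrite sE.
  have := congr1 (last 0) sss.
  by rewrite -[0]/(size (Nil rat)) last_map -[size [::]]/(ones [::]) last_map last_block_ones.
have first_part : mask (map in_first t) (place (x :: s) zs) = place (belast x s) ss.
  by rewrite F2 lastI place_rcons0 // size_belast sz.
have second_part : mask (map in_second t) (place (x :: s) zs) = place s ss by rewrite F3.
have [belast_m s_m] : all (gtn m) (belast x s) /\ all (gtn m) s.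
  by move: (lt_m); rewrite {1}lastI all_rcons => /andP[_ ->]; case/andP: lt_m.
set z := place (x :: s) zs in F1 first_part second_part *.
have z_srt : sorted <%O z by apply: place_sorted.
have zP : {subset z <= P}.
  move=> q /(mem_masks wf F1); rewrite first_part second_part.
  by case; apply: mem_place.
have [|zo zoE] := @map_val_ord n (map (count_below P) z).
  apply/allP => _ /mapP[q /zP qP ->] /=.
  by apply: leq_trans mkn; rewrite -sP count_below_size.
have zo_srt : sorted <%O zo.
  have : sorted ltn (map val zo).
    rewrite zoE sorted_map; apply: (sub_in_sorted (P := mem z)) z_srt; last first.
      by apply/allP.
    by move=> p q /zP pP _; apply: count_below_lt.
  by rewrite sorted_map; apply: sub_sorted => i j; rewrite ltEord.
have zo_size : size zo = size t by rewrite -F1 -(size_map val) zoE size_map.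
have UE xs (b : seq bool) : mask b z = place xs ss -> U xs =i mask b zo.
  move=> bE i; rewrite !inE -bE map_mask -zoE -map_mask.
  by rewrite (mem_map val_inj).
have U_card xs (b : seq bool) : mask b z = place xs ss -> size b = size t ->
    count id b = k -> #|U xs| == k.
  move=> bE sb ck; rewrite (eq_card (UE xs b bE)) -ck.
  rewrite -(size_mask (s := zo)) ?zo_size //; apply/eqP/card_uniqP.
  exact/mask_uniq/lt_sorted_uniq.
have U1 : #|U (belast x s)| == k.
  by apply: U_card first_part _ _; rewrite ?size_map // -ones_first.
have U2 : #|U s| == k.
  by apply: U_card second_part _ _; rewrite ?size_map // -twos_second.
rewrite /g (insubT (fun A : {set 'I_n} => #|A| == k) U1).
rewrite (insubT (fun A : {set 'I_n} => #|A| == k) U2) /=.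
case=> E; apply: f_ok E; rewrite /type_graph; apply/orP; left; apply/eqP.
apply: order_typeE wf zo_srt zo_size _ _ => i; rewrite in_fset !SubK.
  exact: UE first_part i.
exact: UE second_part i.
Qed.

End LowerBound.

(** * Growth of iterated logarithms *)

Section Asymptotics.
Local Open Scope classical_set_scope.
Local Open Scope ring_scope.
Variable R : realType.
Implicit Types (u v : nat -> R) (A B : R).

Lemma ln2_gt0 : 0 < ln 2 :> R.
Proof. by rewrite ln_gt0 // ltr1n. Qed.

Lemma iter_log2S t (x : R) : iter_log2 t.+1 x = iter_log2 t (log2 x).
Proof. exact: iterSr. Qed.

Lemma log2_ge0 (x : R) : 1 <= x -> 0 <= log2 x.
Proof. by move=> x1; rewrite divr_ge0 ?ln_ge0 ?ler1n. Qed.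

Lemma log2_le (x y : R) : 0 < x -> x <= y -> log2 x <= log2 y.
Proof.
move=> x0 xy; rewrite ler_pM2r ?invr_gt0 ?ln2_gt0 // ler_ln ?posrE //.
exact: lt_le_trans xy.
Qed.

Lemma log2M (x y : R) : 0 < x -> 0 < y -> log2 (x * y) = log2 x + log2 y.
Proof. by move=> x0 y0; rewrite /log2 lnM ?posrE // mulrDl. Qed.

Lemma log2X n : log2 (2 ^+ n) = n%:R :> R.
Proof.
by rewrite /log2 lnXn ?ltr0n // -[_ *+ n]mulr_natl mulfK // gt_eqF // ln2_gt0.
Qed.

Lemma log2_le0 (x : R) : x <= 0 -> log2 x = 0.
Proof. by move=> x0; rewrite /log2 ln0 // mul0r. Qed.

Lemma log2_cvgy v : v n @[n --> \oo] --> +oo -> log2 (v n) @[n --> \oo] --> +oo.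
Proof.
move=> /cvgryPge vy; apply/cvgryPge => A.
apply: filterS (vy (expR (A * ln 2))) => n le.
rewrite /log2 ler_pdivlMr ?ln2_gt0 // -[A * _]expRK ler_ln ?posrE ?expR_gt0 //.
by apply: lt_le_trans le; apply: expR_gt0.
Qed.

Lemma iter_log2_cvgy t v :
  v n @[n --> \oo] --> +oo -> iter_log2 t (v n) @[n --> \oo] --> +oo.
Proof. by elim: t v => [|t IH] v vy //; apply/log2_cvgy/IH. Qed.

Lemma log2_near u v A B : v n @[n --> \oo] --> +oo ->
    (\forall n \near \oo, u n <= A * v n + B) ->
  exists B', \forall n \near \oo, log2 (u n) <= log2 (v n) + B'.
Proof.
move=> /cvgryPge vy uv; pose C := `|A| + `|B| + 1.
have C1 : 1 <= C by rewrite /C lerDr addr_ge0.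
exists (log2 C); near=> n.
have v1 : 1 <= v n by near: n; apply: vy.
have [u0|u0] := leP (u n) 0; first by rewrite log2_le0 // addr_ge0 ?log2_ge0.
have v0 : 0 < v n by apply: lt_le_trans v1.
have C0 : 0 < C by apply: lt_le_trans C1.
rewrite addrC -log2M // log2_le //.
apply: (@le_trans _ _ (A * v n + B)); first by near: n.
rewrite /C !mulrDl -addrA lerD ?ler_wpM2r ?ler_norm ?(ltW v0) //.
rewrite mul1r (le_trans (ler_norm B)) // -[leLHS]addr0 lerD ?(ltW v0) //.
by rewrite ler_peMr.
Unshelve. all: by end_near. Qed.

(** One logarithm already turns the factor into an additive constant; [A] is kept to include
    [t = 0]. *)
Lemma iter_log2_near t u v A B : 1 <= A -> v n @[n --> \oo] --> +oo ->
    (\forall n \near \oo, u n <= A * v n + B) ->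
  exists B', \forall n \near \oo, iter_log2 t (u n) <= A * iter_log2 t (v n) + B'.
Proof.
move=> A1; elim: t u v B => [|t IH] u v B vy uv; first by exists B.
have [B' uv'] := log2_near vy uv.
have vy' := log2_cvgy vy.
have [|B'' uv''] := IH (fun n => log2 (u n)) (fun n => log2 (v n)) B' vy'.
  near=> n; apply: (@le_trans _ _ (log2 (v n) + B')); first by near: n.
  rewrite lerD2r ler_peMl //; near: n.
  by move/cvgryPge: vy' => /(_ 0).
exists B''; apply: filterS uv'' => n; by rewrite !iter_log2S.
Unshelve. all: by end_near. Qed.

Lemma iter_log2_tower t (x : R) c :
  x <= (iter t (expn 2) c)%:R -> iter_log2 t x <= c%:R.
Proof.
elim: t x => [|t IH] x //; rewrite iter_log2S => le; apply: IH.
have [x0|x0] := leP x 0; first by rewrite log2_le0.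
by apply: le_trans (log2_le x0 le) _; rewrite iterS natrX log2X.
Qed.

(** General sequences [N] let the induction pass to [(trunc_log 2 (N n)).+2]. The exponents add up
    as (2 d + 1) + d^2 = (d + 1)^2, and lower terms go into [B]. *)
Lemma ibound_near d (N : nat -> nat) : (N n)%:R @[n --> \oo] --> (+oo : set_system R) ->
  exists B : R, \forall n \near \oo,
    (ibound d (N n))%:R <= 2 ^+ (d ^ 2) * iter_log2 d (N n)%:R + B.
Proof.
elim: d N => [|d IH] N Ny.
  by exists 1; near=> n; rewrite expr0 mul1r /iter_log2 /= -natr1.
have N0 : \forall n \near \oo, (0 < N n)%N.
  by move/cvgryPge: Ny => /(_ 1); apply: filterS => n; rewrite ler1n.
pose N' n := (trunc_log 2 (N n)).+2.
have lo n : (0 < N n)%N -> (N' n)%:R <= 1 * log2 (N n)%:R + 2 :> R.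
  move=> n0; rewrite /N' -addn2 natrD mul1r lerD2r -log2X log2_le ?exprn_gt0 //.
  by rewrite -natrX ler_nat trunc_logP.
have hi n : (0 < N n)%N -> log2 (N n)%:R <= (N' n)%:R :> R.
  move=> n0; rewrite -[leRHS]log2X log2_le ?ltr0n //.
  rewrite -natrX ler_nat; apply/ltnW/(leq_trans (trunc_log_ltn (N n) (isT : 1 < 2)%N)).
  by rewrite leq_exp2l.
have Ly := log2_cvgy Ny.
have N'y : (N' n)%:R @[n --> \oo] --> (+oo : set_system R).
  move/cvgryPge: Ly => Ly; apply/cvgryPge => A; near=> n.
  apply: (@le_trans _ _ (log2 (N n)%:R)); first by near: n; apply: Ly.
  by apply: hi; near: n.
have [B HB] := IH N' N'y.
have [|B' HB'] := iter_log2_near d (u := fun n => (N' n)%:R) (A := 1) (B := 2) (lexx _) Ly.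
  by apply: filterS N0 => n; apply: lo.
exists (2 ^+ (d + d).+1 * (2 ^+ (d ^ 2) * B' + B + 2 ^+ (d + d))); near=> n.
rewrite [ibound _ _]/= natrM natrD !natrX.
have -> : 2 ^+ (d.+1 ^ 2) = 2 ^+ (d + d).+1 * 2 ^+ (d ^ 2) :> R.
  by rewrite -exprD; congr (_ ^+ _); lia.
rewrite -mulrA -mulrDr ler_pM2l ?exprn_gt0 // addrA lerD2r addrA -mulrDr.
apply: (@le_trans _ _ (2 ^+ (d ^ 2) * iter_log2 d (N' n)%:R + B)); first by near: n.
rewrite lerD2r ler_pM2l ?exprn_gt0 // iter_log2S.
by rewrite -[X in X + _]mul1r; near: n.
Unshelve. all: by end_near. Qed.

Lemma cvgy_divr v B : v n @[n --> \oo] --> +oo -> B / v n @[n --> \oo] --> (0 : R).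
Proof.
move=> /cvgryPge vy; apply/cvgr0Pnorm_le => e e0; near=> n.
have ve : (`|B| + 1) / e <= v n by near: n; apply: vy.
have v0 : 0 < v n by apply: lt_le_trans ve; rewrite divr_gt0 // ltr_wpDl.
rewrite normrM normfV (gtr0_norm v0) ler_pdivrMr //.
rewrite mulrC -ler_pdivrMr //; apply: le_trans ve.
by rewrite ler_pM2r ?invr_gt0 // lerDl.
Unshelve. all: by end_near. Qed.

End Asymptotics.

(** * Asymptotic form of the bounds *)

Section LowerBoundNear.
Local Open Scope classical_set_scope.
Local Open Scope ring_scope.
Variables (R : realType) (k d : nat) (t : seq nat).
Hypotheses (kt : is_type_of_width k t) (irr : irreducible_type t).
Hypotheses (hd : (head 0 t = 1)%N) (size_bs : size (primary_blocks t) = d.+2).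

Lemma type_width_gt0 : (0 < k)%N.
Proof.
have [_ <- _] := (is_type_of_widthE k t).1 kt.
by case: t hd => //= a s ->.
Qed.

Lemma chromatic_number_ge n :
  (n %/ k <= iter d (expn 2) (chromatic_number (@type_graph n k t)).+1)%N.
Proof.
have nt := nontrivial_primary hd.
have [/existsP[f /forallP f_ok] _] :=
  chromatic_numberP (type_graph_irrefl (n := n) (k := k) nt).
rewrite -[X in (_ <= iter _ _ X.+1)%N]card_ord.
apply: (shift_graph_hom kt irr hd size_bs (f := f) (leq_trunc_div n k)) => X Y XY.
by have /forallP/(_ Y)/implyP/(_ XY)/eqP := f_ok X.
Qed.

Lemma natr_cvgy : (n%:R : R) @[n --> \oo] --> +oo.
Proof. exact: cvgr_idn. Qed.

Lemma natr_div_cvgy : (n%:R / k%:R : R) @[n --> \oo] --> +oo.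
Proof.
have k0 : 0 < k%:R :> R by rewrite ltr0n type_width_gt0.
move/cvgryPge: natr_cvgy => ny; apply/cvgryPge => A.
by apply: filterS (ny (A * k%:R)) => n; rewrite ler_pdivlMr.
Qed.

Lemma chromatic_number_ge_near : exists B : R, \forall n \near \oo,
  iter_log2 d (n%:R / k%:R) <= (chromatic_number (@type_graph n k t))%:R + B.
Proof.
have k0 : 0 < k%:R :> R by rewrite ltr0n type_width_gt0.
have div_ge n : n%:R / k%:R <= 1 * (n %/ k)%:R + 1 :> R.
  rewrite mul1r natr1 ler_pdivrMr // -natrM ler_nat ltnW //.
  exact/ltn_ceil/type_width_gt0.
have div_cvgy : ((n %/ k)%:R : R) @[n --> \oo] --> +oo.
  move/cvgryPge: natr_div_cvgy => ny; apply/cvgryPge => A.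
  apply: filterS (ny (A + 1)) => n /le_trans/(_ (div_ge n)).
  by rewrite mul1r lerD2r.
have [|B HB] := iter_log2_near d (lexx 1) div_cvgy (B := 1) (u := fun n => n%:R / k%:R).
  by near=> n; apply: div_ge.
exists (1 + B); near=> n; rewrite addrA.
apply: (@le_trans _ _ (1 * iter_log2 d (n %/ k)%:R + B)); first by near: n.
rewrite mul1r lerD2r natr1; apply: iter_log2_tower.
by rewrite ler_nat; apply: chromatic_number_ge.
Unshelve. all: by end_near. Qed.

Lemma iter_log2_div_near : exists B : R, \forall n \near \oo,
  iter_log2 d n%:R <= k%:R * iter_log2 d (n%:R / k%:R) + B.
Proof.
have k0 : 0 < k%:R :> R by rewrite ltr0n type_width_gt0.
apply: (@iter_log2_near R d _ _ _ 0) => //; first by rewrite ler1n type_width_gt0.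
  exact: natr_div_cvgy.
by near=> n; rewrite addr0 mulrC divfK // gt_eqF.
Unshelve. all: by end_near. Qed.

End LowerBoundNear.

Local Open Scope classical_set_scope.
Local Open Scope ring_scope.

Theorem theorem1p7 (R : realType) (k b : nat) (tau : seq nat)
  (tau_type : is_type_of_width k tau)
  (tau_nontrivial : ~~ trivial_type tau)
  (tau_irreducible : irreducible_type tau)
  (tau_blocks : size (blocks tau) = b) :
  let chi (n : nat) : R := (chromatic_number (@type_graph n k tau))%:R in
  [/\ exists eps : nat -> R,
        eps n @[n --> \oo] --> 0 /\
        \forall n \near \oo,
          (1 + eps n) * iter_log2 (b - 2) (n%:R / k%:R) <= chi n,
      exists delta : nat -> R,
        delta n @[n --> \oo] --> 0 /\
        \forall n \near \oo,
          chi n <= (2 ^+ ((b - 2) ^ 2) + delta n) * iter_log2 (b - 2) n%:R &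
      chi \is 'Theta_\oo (fun n : nat => iter_log2 (b - 2) n%:R : R)].
Proof.
have [t [kt irr hd bE graphE]] :=
  primary_reduction tau_type tau_nontrivial tau_irreducible.
have [_ _] := primary_blocksP kt irr hd; rewrite bE tau_blocks => b_gt1.
rewrite tau_blocks in bE; have [d dE] : exists d, b = d.+2 by case: b b_gt1 {tau_blocks bE} => [|[|d]] // _; exists d.
rewrite dE in bE; rewrite dE !subSS subn0 => chi.
have chiE n : chi n = (chromatic_number (@type_graph n k t))%:R.
  by rewrite /chi graphE.
have [B1 H1] := chromatic_number_ge_near R kt irr hd bE.
have [B3 H3] := iter_log2_div_near R d kt hd.
have [B2 H2] := ibound_near (R := R) d (N := id) (@natr_cvgy R).
have {}H2 : \forall n \near \oo, chi n <= 2 ^+ (d ^ 2) * iter_log2 d n%:R + B2.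
  near=> n; rewrite chiE; apply: le_trans (_ : (ibound d n)%:R <= _).
    by rewrite ler_nat; apply: (chromatic_number_le kt irr hd bE).
  by near: n.
have {}H1 : \forall n \near \oo, iter_log2 d (n%:R / k%:R) <= chi n + B1.
  by apply: filterS H1 => n; rewrite chiE.
have Ly := iter_log2_cvgy (d) (@natr_cvgy R).
have Lky := iter_log2_cvgy (d) (natr_div_cvgy (R := R) kt hd).
have Lpos : \forall n \near \oo, 0 < iter_log2 d (n%:R : R).
  by move/cvgryPgt: Ly; apply.
split.
(* The o(1) terms are the additive errors divided by divergent logarithms. *)
- exists (fun n => - B1 / iter_log2 d (n%:R / k%:R)); split; first exact: cvgy_divr.
  near=> n; have L0 : 0 < iter_log2 d (n%:R / k%:R : R).
    by near: n; move/cvgryPgt: Lky; apply.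
  rewrite mulrDl mul1r divfK ?gt_eqF // lerBlDr.
  by near: n.
- exists (fun n => B2 / iter_log2 d n%:R); split; first exact: cvgy_divr.
  near=> n; have L0 : 0 < iter_log2 d (n%:R : R) by near: n.
  by rewrite mulrDl divfK ?gt_eqF //; near: n.
have k0 : 0 < k%:R :> R by rewrite ltr0n (type_width_gt0 kt).
have k2 : 0 < k%:R *+ 2 :> R by rewrite mulr2n addr_gt0.
rewrite qualifE; apply/asboolP.
(* The factor [k] pays for replacing n / k by n; the 2 absorbs the additive errors once the
   logarithm is at least [(k%:R * B1 + B3) * 2]. *)
exists ((k%:R *+ 2)^-1, 2 ^+ (d ^ 2) + `|B2|) => /=.
  by rewrite invr_gt0 k2 ltr_wpDr // exprn_gt0.
near=> n; have L0 : 0 < iter_log2 d (n%:R : R) by near: n.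
have c0 : 0 <= chi n by rewrite /chi ler0n.
rewrite (gtr0_norm L0) (ger0_norm c0); split.
  have Lbig : (k%:R * B1 + B3) * 2 <= iter_log2 d (n%:R : R).
    by near: n; move/cvgryPge: Ly; apply.
  have h3 : iter_log2 d n%:R <= k%:R * iter_log2 d (n%:R / k%:R) + B3 by near: n.
  have h1 : iter_log2 d (n%:R / k%:R) <= chi n + B1 by near: n.
  have h : iter_log2 d n%:R <= k%:R * (chi n + B1) + B3.
    by apply: le_trans h3 _; rewrite lerD2r ler_pM2l.
  rewrite mulrC ler_pdivrMr //.
  rewrite -[k%:R *+ 2]mulr_natr mulrA [chi n * _]mulrC.
  move: h Lbig; rewrite mulrDr.
  by move: (iter_log2 d n%:R) (k%:R * chi n) (k%:R * B1) => x y z; lra.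
have h2 : chi n <= 2 ^+ (d ^ 2) * iter_log2 d n%:R + B2 by near: n.
apply: (le_trans h2); rewrite mulrDl lerD2l.
have L1 : 1 <= iter_log2 d (n%:R : R) by near: n; move/cvgryPge: Ly; apply.
by apply: le_trans (ler_norm B2) _; rewrite ler_peMr.
Unshelve. all: by end_near. Qed.
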